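(* Let $S=(S^1,\dots,S^d)\in D([0,T];\mathbb{R}^d)$ and let $\mathcal{P}^n=\{0=t^n_0<t^n_1<\cdots<t^n_{N_n}=T\}$, $n\in\mathbb{N}$, be a sequence of nested partitions ($\mathcal{P}^n\subset\mathcal{P}^{n+1}$) with vanishing mesh size. The following conditions are equivalent: (i) For every pair $(i,j)$, the Riemann sums $\int_0^tS^{n,i}_u\,\mathrm{d}S^j_u+\int_0^tS^{n,j}_u\,\mathrm{d}S^i_u$ converge, uniformly in $t\in[0,T]$, to a limit, which is denoted by $\int_0^tS^i_u\,\mathrm{d}S^j_u+\int_0^tS^j_u\,\mathrm{d}S^i_u$. (ii) For every pair $(i,j)$, the discrete quadratic variation $\langle S^i,S^j\rangle^n$ converges uniformly on $[0,T]$ to a càdlàg path, which is denoted by $\langle S^i,S^j\rangle$. (iii) The path $S$ has quadratic variation along $(\mathcal{P}^n)_{n\in\mathbb{N}}$ in the sense of Föllmer. Moreover, if these conditions hold then the path $\langle S^i,S^j\rangle$ has finite total variation and, for every $(i,j)$, we have $[S^i,S^j]=\langle S^i,S^j\rangle$ and the equality $$S^i_tS^j_t=S^i_0S^j_0+\int_0^tS^i_u\,\mathrm{d}S^j_u+\int_0^tS^j_u\,\mathrm{d}S^i_u+\langle S^i,S^j\rangle_t$$ holds for every $t\in[0,T]$.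
   Context: $D([0,T];\mathbb{R}^d)$ is the space of càdlàg functions $[0,T]\to\mathbb{R}^d$. For a path $A$ write $A_{s,t}:=A_t-A_s$ and $A_{s-,s}:=A_s-A_{s-}$. For $i=1,\dots,d$: $S^{n,i}_t:=S^i_T\mathbf{1}_{\{T\}}(t)+\sum_{k=0}^{N_n-1}S^i_{t^n_k}\mathbf{1}_{[t^n_k,t^n_{k+1})}(t)$, and $\int_0^tS^{n,i}_u\,\mathrm{d}S^j_u:=\sum_{k=0}^{N_n-1}S^i_{t^n_k}S^j_{t^n_k\wedge t,t^n_{k+1}\wedge t}$. The discrete quadratic variation is $\langle S^i,S^j\rangle^n_t:=\sum_{k=0}^{N_n-1}S^i_{t^n_k\wedge t,t^n_{k+1}\wedge t}\,S^j_{t^n_k\wedge t,t^n_{k+1}\wedge t}$, $t\in[0,T]$. Quadratic variation in the sense of Föllmer: a path $S\in D([0,T];\mathbb{R})$ has quadratic variation along $(\mathcal{P}^n)$ in the sense of Föllmer if the measures $\mu_n:=\sum_{k=0}^{N_n-1}|S_{t^n_k,t^n_{k+1}}|^2\delta_{t^n_k}$ on the Borel sets of $[0,T]$ converge weakly to a measure $\mu$ such that $t\mapsto[S]^c_t:=\mu([0,t])-\sum_{0<s\le t}|S_{s-,s}|^2$ is continuous and increasing (i.e. non-decreasing); then $[S]_t:=\mu([0,t])$ is called the quadratic variation of $S$. A path $S\in D([0,T];\mathbb{R}^d)$ has quadratic variation along $(\mathcal{P}^n)$ in the sense of Föllmer if this holds for $S^i$ and $S^i+S^j$ for every $(i,j)$,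 and then $[S^i,S^j]:=\frac12([S^i+S^j]-[S^i]-[S^j])$.
   Formalization: In (iii) the limit measure μ is also required to have no atom at 0 (that is, [S]^c_0 = 0); without this a continuous path whose oscillations accumulate at 0 can have μ = δ_0, so that (iii) holds while (i) and (ii) fail. *)

(* Defs.v *)
From HB Require Import structures.
From mathcomp Require Import all_boot all_order all_algebra.
From mathcomp Require Import all_classical all_reals all_analysis.

Set Implicit Arguments.
Unset Strict Implicit.
Unset Printing Implicit Defensive.

Import Order.TTheory GRing.Theory Num.Theory.
Import numFieldNormedType.Exports.

Local Open Scope classical_set_scope.
Local Open Scope ring_scope.

(* A path on [0, T] is a total function on R of which only the values on
   [0, T] matter. A partition {0 = t_0 < ... < t_N = T} is the sequence
   p = [:: t_1; ...; t_N] with [itv_partition 0 T p]; thus N = size p. *)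

Section Paths.
Context {R : realType}.
Implicit Types (T t s : R) (p : seq R) (P : nat -> seq R) (f g q : R -> R).

Definition cadlag {V : topologicalType} T (f : R -> V) : Prop :=
  (forall t, 0 <= t < T -> f x @[x --> t^'+] --> f t) /\
  (forall t, 0 < t <= T -> exists l : V, f x @[x --> t^'-] --> l).

(* f_{s-,s} *)
Definition jump f s : R := f s - lim (f x @[x --> s^'-]).

(* t_k; the default value 0 is never used for k <= N *)
Definition ppoint p (k : nat) : R := nth 0 (0 :: p) k.

Definition mesh p : R :=
  \big[Num.max/0]_(k < size p) (ppoint p k.+1 - ppoint p k).

Definition nested_vanishing_partitions T P : Prop :=
  [/\ forall n, itv_partition 0 T (P n),
      forall n, {subset 0 :: P n <= 0 :: P n.+1}
    & mesh (P n) @[n --> \oo] --> (0 : R)].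

(* f_{t_k /\ t, t_{k+1} /\ t} *)
Definition stopped_incr p f t (k : nat) : R :=
  f (Num.min (ppoint p k.+1) t) - f (Num.min (ppoint p k) t).

(* int_0^t f^n_u dg_u, where f^n is the piecewise constant approximation of f
   along p *)
Definition riemann_sum p f g t : R :=
  \sum_(k < size p) f (ppoint p k) * stopped_incr p g t k.

Definition sym_riemann_sum p f g t : R :=
  riemann_sum p f g t + riemann_sum p g f t.

Definition discrete_qv p f g t : R :=
  \sum_(k < size p) stopped_incr p f t k * stopped_incr p g t k.

(* int_0^t f_u dg_u + int_0^t g_u df_u *)
Definition sym_integral P f g t : R :=
  limn (fun n => sym_riemann_sum (P n) f g t).

(* <f, g>_t *)
Definition bracket P f g t : R :=
  limn (fun n => discrete_qv (P n) f g t).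

(* sum_k |f_{t_k, t_{k+1}}|^2 delta_{t_k} *)
Definition sq_incr_measure p f : {measure set (measurableTypeR R) -> \bar R} :=
  msum (fun k => mscale
      (NngNum (sqr_ge0 (f (ppoint p k.+1) - f (ppoint p k))))
      (dirac (ppoint p k : measurableTypeR R)))
    (size p).

(* Weak convergence of measures on the compact interval [0, T], on which
   continuous functions are automatically bounded. *)
Definition weak_cvg_on T
    (mu_ : nat -> {measure set (measurableTypeR R) -> \bar R})
    (mu : {measure set (measurableTypeR R) -> \bar R}) : Prop :=
  forall h : R -> R, {within `[0, T], continuous h} ->
    (\int[mu_ n]_(x in `[0%R, T]) (h x)%:E)%E @[n --> \oo] -->
    (\int[mu]_(x in `[0%R, T]) (h x)%:E)%E.

(* [f]^c_t. It is extended-real valued so that a divergent sum of squared jumps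
   is not silently replaced by 0. *)
Definition continuous_part
    (mu : {measure set (measurableTypeR R) -> \bar R}) f t : \bar R :=
  (mu `[0%R, t]%classic - \esum_(s in `]0%R, t]) (jump f s ^+ 2)%:E)%E.

(* mu is a measure on [0, T], i.e. a Borel measure on R vanishing outside
   [0, T].
   The clause [continuous_part mu f 0 = 0] (i.e. mu has no atom at 0) is the
   continuity of [f]^c at 0 under the usual convention [f]^c_{0-} = 0: in
   Foellmer's definition the atoms of mu are exactly the squared jumps of f,
   and 0 is not a jump time. Continuity on [0, T] alone does not exclude such
   an atom: oscillations accumulating at 0 can produce mu = delta_0 for a
   continuous f, while <f, f>^n_0 = 0 for all n. *)
Definition follmer_measure T P f
    (mu : {finite_measure set (measurableTypeR R) -> \bar R}) : Prop :=
  [/\ mu (~` `[0, T]%classic) = 0%E,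
      weak_cvg_on T (fun n => sq_incr_measure (P n) f) mu,
      {within `[0, T], continuous (continuous_part mu f)},
      {in `[0, T] &,
         {homo continuous_part mu f : s t / s <= t >-> (s <= t)%E}}
    & continuous_part mu f 0 = 0%E].

Definition has_follmer_qv1 T P f : Prop :=
  exists mu : {finite_measure set (measurableTypeR R) -> \bar R},
    follmer_measure T P f mu.

(* [f]_t = mu([0, t]), where mu is the weak limit above (determined by f) *)
Definition follmer_qv T P f : R -> R :=
  get [set q | exists2 mu : {finite_measure set (measurableTypeR R) -> \bar R},
         follmer_measure T P f mu & forall t, q t = fine (mu `[0, t]%classic)].

(* [f, g] *)
Definition follmer_covariation T P f g t : R :=
  2^-1 * (follmer_qv T P (f \+ g) t - follmer_qv T P f t - follmer_qv T P g t).

Definition component d (S : R -> 'rV[R]_d) (i : 'I_d) : R -> R :=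
  fun t => S t ord0 i.

Definition has_follmer_qv d T P (S : R -> 'rV[R]_d) : Prop :=
  forall i j : 'I_d, has_follmer_qv1 T P (component S i) /\
                     has_follmer_qv1 T P (component S i \+ component S j).

Definition riemann_sums_cvg d T P (S : R -> 'rV[R]_d) : Prop :=
  forall i j : 'I_d, exists I : R -> R,
    {uniform `[0, T],
      (fun n => sym_riemann_sum (P n) (component S i) (component S j)) @ \oo --> I}.

Definition discrete_qv_cvg d T P (S : R -> 'rV[R]_d) : Prop :=
  forall i j : 'I_d, exists2 Q : R -> R, cadlag T Q &
    {uniform `[0, T],
      (fun n => discrete_qv (P n) (component S i) (component S j)) @ \oo --> Q}.

End Paths.

(* Main.v *)
Require Import Defs.
From HB Require Import structures.
From mathcomp Require Import all_boot all_order all_algebra.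
From mathcomp Require Import all_classical all_reals all_analysis.
From mathcomp Require Import measurable_realfun ring lra.
Import Order.TTheory GRing.Theory Num.Theory.
Import numFieldNormedType.Exports.
Local Open Scope classical_set_scope.
Local Open Scope ring_scope.

Set Implicit Arguments.
Unset Strict Implicit.
Unset Printing Implicit Defensive.

(* Discrete integration by parts turns the Riemann sums into discrete quadratic
   variations, and polarization reduces everything to <f, f>^n for a single path
   f (one of the S^i or S^i + S^j). Both (ii) and (iii) then amount to the
   existence of a nondecreasing cadlag path Q with jumps (f_{s-,s})^2 which is
   the pointwise limit of <f, f>^n.

   - If t_k < t <= t_{k+1}, then <f, f>^n_t and mu_n([0, t[) differ by
     (f_t - f_{t_k})^2 - (f_{t_{k+1}} - f_{t_k})^2, which tends to 0 because
     t_k tends to t strictly from the left and t_{k+1} from the right. Hence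
     weak convergence of mu_n and pointwise convergence of <f, f>^n are
     equivalent, Q being the distribution function of the limit measure.
   - <f, f>^n is nondecreasing up to an error controlled by the oscillation of
     f, and its increments near t reproduce (f_{t-,t})^2; together with the
     compactness of [0, T] this makes pointwise convergence uniform.
   - Continuity and monotonicity of [f]^c say exactly that the atoms of mu are
     the squared jumps of f. *)

(** * Partitions *)

(** The obstacle is that <f,f>^n is not monotone: inside a partition interval its last term is (f_t
    - f_{t_k})^2, which may fall back. Moreover f has no modulus of continuity valid on all of
    [0, T], so each estimate is local, on one side of a fixed time t, where f stays close to f_t or
    to f_{t-}.

    Jumps dictate the choice t_k < t <= t_{k+1}: then f_{t_k} tends to f_{t-} and f_{t_{k+1}} to
    f_t, even when t is a partition point. So mu_n places the squared jump at t_k, strictly before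
    t, and mu_n([0,t[) tends to mu([0,t]), atom at t included. This is why the limit holds at every
    t, whereas weak convergence by itself gives convergence of distribution functions only at
    continuity points. *)

Section Partition.
Context {R : realType}.
Variables (T : R) (p : seq R).
Hypothesis pT : itv_partition 0 T p.
Implicit Types (f g h : R -> R) (s t u : R).

Lemma ppoint_size : ppoint p (size p) = T.
Proof. by have := itv_partition_nth_size 0 pT. Qed.

Lemma ppoint_lt i j : (i < j)%N -> (j <= size p)%N -> ppoint p i < ppoint p j.
Proof.
move=> ij jp; case: pT => /= sp _.
have := @sorted_ltn_nth _ <%O lt_trans 0 (0 :: p) sp i j.
by rewrite !inE /= !ltnS; apply => //; rewrite (leq_trans _ jp)// ltnW.
Qed.

Lemma ppoint_le i j : (i <= j)%N -> (j <= size p)%N -> ppoint p i <= ppoint p j.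
Proof.
by rewrite leq_eqVlt => /predU1P[->//|ij] jp; apply/ltW/ppoint_lt.
Qed.

Lemma ppoint_ge0 k : (k <= size p)%N -> 0 <= ppoint p k.
Proof. by move=> kp; have := @ppoint_le 0 k (leq0n _) kp. Qed.

Lemma ppoint_leT k : (k <= size p)%N -> ppoint p k <= T.
Proof. by move=> kp; rewrite -ppoint_size ppoint_le. Qed.

(** Left-open bracketing, for arguments at a jump time: the increment starts strictly before t and
    therefore contains the jump at t. *)
Lemma ppoint_bracket_oc t : 0 < t <= T ->
  exists2 k, (k < size p)%N & ppoint p k < t <= ppoint p k.+1.
Proof.
move=> /andP[t0 tT].
have ex : exists k, t <= ppoint p k by exists (size p); rewrite ppoint_size.
case: (ex_minnP ex) => -[|k]; first by rewrite leNgt t0.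
move=> tk kmin; exists k.
  by apply: kmin; rewrite ppoint_size.
by rewrite tk andbT ltNge; apply/negP => /kmin; rewrite ltnn.
Qed.

(** Right-open bracketing, for arguments that need room to the right of t inside one partition
    interval, and for evaluating step functions. *)
Lemma ppoint_bracket_co t : 0 <= t < T ->
  exists2 k, (k < size p)%N & ppoint p k <= t < ppoint p k.+1.
Proof.
move=> /andP[t0 tT].
have ex : exists k, t < ppoint p k by exists (size p); rewrite ppoint_size.
case: (ex_minnP ex) => -[|k]; first by rewrite ltNge t0.
move=> tk kmin; exists k.
  by apply: kmin; rewrite ppoint_size.
by rewrite tk andbT leNgt; apply/negP => /kmin; rewrite ltnn.
Qed.

Lemma le_mesh k : (k < size p)%N -> ppoint p k.+1 - ppoint p k <= mesh p.
Proof.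
move=> kp; rewrite /mesh.
exact: (le_bigmax _ (fun k : 'I_(size p) => ppoint p k.+1 - ppoint p k) (Ordinal kp)).
Qed.

Lemma integration_by_parts_discrete f g t : 0 <= t <= T ->
  f t * g t = f 0 * g 0 + sym_riemann_sum p f g t + discrete_qv p f g t.
Proof.
move=> /andP[t0 tT].
rewrite -addrA -[LHS](subrKC (f 0 * g 0)); congr (_ + _).
rewrite /sym_riemann_sum /riemann_sum /discrete_qv -!big_split/=.
pose F k := f (Num.min (ppoint p k) t) * g (Num.min (ppoint p k) t).
transitivity (F (size p) - F 0%N).
  by rewrite /F ppoint_size (min_idPr tT) (min_idPl t0).
rewrite -(telescope_sumr F)// big_mkord; apply: eq_bigr => k _.
(* For t_k <= t each summand is the discrete product rule. For t < t_k the Riemann sums still read f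
   and g at the unstopped point t_k, but every stopped increment vanishes. *)
rewrite /F /stopped_incr; have [kt|tk] := leP (ppoint p k) t.
  by ring.
rewrite min_r; last exact: (le_trans (ltW tk) (ppoint_le _ _)).
by ring.
Qed.

Lemma discrete_qv_polarization f g t : discrete_qv p f g t =
  2^-1 * (discrete_qv p (f \+ g) (f \+ g) t - discrete_qv p f f t
          - discrete_qv p g g t).
Proof.
rewrite /discrete_qv -!sumrB mulr_sumr; apply: eq_bigr => k _.
by rewrite /stopped_incr /=; field.
Qed.

(* mu_n([0, t_k[) *)
Definition sq_incr_sum f k : R :=
  \sum_(i < k) (f (ppoint p i.+1) - f (ppoint p i)) ^+ 2.

Lemma sq_incr_sumS f k : sq_incr_sum f k.+1 =
  sq_incr_sum f k + (f (ppoint p k.+1) - f (ppoint p k)) ^+ 2.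
Proof. by rewrite /sq_incr_sum big_ord_recr. Qed.

Lemma sq_incr_sum_le f i j : (i <= j)%N -> sq_incr_sum f i <= sq_incr_sum f j.
Proof.
move=> /subnK <-; elim: (j - i)%N => // k ih.
by rewrite addSn sq_incr_sumS (le_trans ih)// lerDl sqr_ge0.
Qed.

(** Stopping at t leaves the earlier increments whole, truncates the k-th and kills the later ones.
    Both endpoints are allowed, so the formula serves either bracketing. *)
Lemma discrete_qvE f k t : (k < size p)%N -> ppoint p k <= t <= ppoint p k.+1 ->
  discrete_qv p f f t = sq_incr_sum f k + (f t - f (ppoint p k)) ^+ 2.
Proof.
move=> kp /andP[kt tk].
rewrite /discrete_qv -(big_mkord xpredT
  (fun k => stopped_incr p f t k * stopped_incr p f t k)).
rewrite (@big_cat_nat _ _ _ k.+1)//= big_nat_recr//=.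
have -> : \sum_(k.+1 <= i < size p) stopped_incr p f t i * stopped_incr p f t i = 0.
  rewrite big_nat big1// => i /andP[ki ip].
  by rewrite /stopped_incr !min_r ?subrr ?mul0r// (le_trans tk)// ppoint_le// ltnW.
rewrite addr0; congr (_ + _); last by rewrite /stopped_incr min_r// min_l// expr2.
rewrite /sq_incr_sum -[RHS](big_mkord xpredT
  (fun i => (f (ppoint p i.+1) - f (ppoint p i)) ^+ 2)) !big_nat.
apply: eq_bigr => i /andP[_ ik].
by rewrite /stopped_incr !min_l -?expr2// (le_trans _ kt)// ppoint_le// ltnW.
Qed.

Lemma discrete_qv0 f : discrete_qv p f f 0 = 0.
Proof.
rewrite /discrete_qv big1// => k _.
by rewrite /stopped_incr !min_r ?subrr ?mul0r// ppoint_ge0// ltnW.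
Qed.

Lemma discrete_qv_ge0 f t : 0 <= discrete_qv p f f t.
Proof. by apply: sumr_ge0 => k _; rewrite -expr2 sqr_ge0. Qed.

Lemma discrete_qv_ppoint f k : (k <= size p)%N ->
  discrete_qv p f f (ppoint p k) = sq_incr_sum f k.
Proof.
case: k => [_|k kp]; first by rewrite discrete_qv0 /sq_incr_sum big_ord0.
by rewrite (@discrete_qvE f k)// ?lexx ?andbT ?ppoint_le// -sq_incr_sumS.
Qed.

(** At a partition point no truncated increment is pending, so from there on squares are only
    added. *)
Lemma sq_incr_sum_le_discrete_qv f k t : (k <= size p)%N -> ppoint p k <= t ->
  t <= T -> sq_incr_sum f k <= discrete_qv p f f t.
Proof.
move=> kp kt tT; have [t0|t0] := leP t 0.
  case: k kp kt => [|k kp kt]; first by rewrite /sq_incr_sum big_ord0 discrete_qv_ge0.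
  by have := ppoint_lt (ltn0Sn k) kp; rewrite ltNge (le_trans kt).
have [|j jp /andP[jt tj]] := @ppoint_bracket_oc t; first by rewrite t0.
rewrite (@discrete_qvE f j)// ?(ltW jt)//.
have [kj|] := leqP k j.
  by rewrite (le_trans (sq_incr_sum_le f kj))// lerDl sqr_ge0.
rewrite leq_eqVlt => /predU1P[jk|jk].
  have -> : t = ppoint p j.+1 by apply/le_anti; rewrite tj jk kt.
  by rewrite -sq_incr_sumS jk.
by have := ppoint_lt jk kp; rewrite ltNge (le_trans kt).
Qed.

(** The difference factors as (a + b - 2c)(a - b). This is the origin of the factor 4M
    throughout. *)
Lemma dist_sqr_le (M a b c : R) : `|a| <= M -> `|b| <= M -> `|c| <= M ->
  `|(a - c) ^+ 2 - (b - c) ^+ 2| <= 4 * M * `|a - b|.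
Proof.
move=> aM bM cM.
have -> : (a - c) ^+ 2 - (b - c) ^+ 2 = (a + b - c - c) * (a - b) by ring.
rewrite normrM ler_wpM2r//.
move: aM bM cM; rewrite !ler_norml => /andP[? ?] /andP[? ?] /andP[? ?].
by apply/andP; split; lra.
Qed.

(* Past the next partition point the sum only grows, so only the increment over
   the partition interval of [s] can decrease it. *)
Lemma discrete_qv_quasi_mono f (M eta : R) s t :
    (forall u, 0 <= u <= T -> `|f u| <= M) -> 0 <= s -> s <= t -> t <= T ->
    (forall u, s <= u <= t -> `|f u - f s| <= eta) ->
  discrete_qv p f f s <= discrete_qv p f f t + 4 * M * eta.
Proof.
move=> fM s0 st tT osc.
have M0 : 0 <= M by rewrite (le_trans _ (fM s _))// s0 (le_trans st).
have eta0 : 0 <= eta by rewrite (le_trans _ (osc s _))// lexx.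
move: s0; rewrite le_eqVlt => /predU1P[<-|s0].
  by rewrite discrete_qv0 addr_ge0 ?discrete_qv_ge0 ?mulr_ge0.
have [|k kp /andP[ks sk]] := @ppoint_bracket_oc s; first by rewrite s0 (le_trans st).
(* From s to r only the k-th increment changes, at a cost of at most 4M eta; beyond r either nothing
   is left or r is a partition point. *)
pose r := Num.min (ppoint p k.+1) t.
have kr : ppoint p k <= r <= ppoint p k.+1.
  by rewrite /r le_min ge_min lexx ppoint_le//= (le_trans (ltW ks)).
have srt : s <= r <= t by rewrite /r le_min ge_min sk st lexx orbT.
have : discrete_qv p f f r <= discrete_qv p f f t.
  rewrite /r; have [kt|//] := leP (ppoint p k.+1) t.
  by rewrite discrete_qv_ppoint// sq_incr_sum_le_discrete_qv.
move=> rt; apply: le_trans (lerD rt (lexx _)).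
rewrite !(@discrete_qvE f k) ?(ltW ks)// -addrA lerD2l -lerBlDl.
have kM : `|f (ppoint p k)| <= M by rewrite fM// ppoint_ge0 ?ppoint_leT// ltnW.
have /andP[? ?] := srt.
apply: le_trans (le_trans (ler_norm _) (dist_sqr_le (fM _ _) (fM _ _) kM)) _.
- by rewrite (ltW s0) (le_trans st).
- by apply/andP; split; lra.
by rewrite distrC ler_wpM2l ?mulr_ge0// osc.
Qed.

End Partition.

(** * Cadlag paths along partitions of vanishing mesh *)

Section Cadlag.
Context {R : realType}.
Variable (T : R).
Implicit Types (f g : R -> R) (e s t u : R).

Lemma near_at_rightP t (A : R -> Prop) :
  (\forall u \near t^'+, A u) <->
  exists2 d : R, 0 < d & forall u, t < u < t + d -> A u.
Proof.
split=> [[d /= d0 H]|[d d0 H]].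
  exists d => // u /andP[tu ud]; apply: H => //=.
  by rewrite ltr0_norm ?subr_lt0// opprB ltrBlDl.
near=> u; apply: H; apply/andP; split; near: u; first exact: nbhs_right_gt.
by apply: nbhs_right_lt; rewrite ltrDl.
Unshelve. all: by end_near. Qed.

Lemma near_at_leftP t (A : R -> Prop) :
  (\forall u \near t^'-, A u) <->
  exists2 d : R, 0 < d & forall u, t - d < u < t -> A u.
Proof.
split=> [[d /= d0 H]|[d d0 H]].
  exists d => // u /andP[tu ud]; apply: H => //=.
  by rewrite gtr0_norm ?subr_gt0// ltrBlDl -ltrBlDr.
near=> u; apply: H; apply/andP; split; near: u; last exact: nbhs_left_lt.
by apply: nbhs_left_gt; rewrite gtrBl.
Unshelve. all: by end_near. Qed.

(** From here on the left limit f_{t-} is written [f t - jump f t]. *)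
Lemma cadlag_cvg_left f t : cadlag T f -> 0 < t <= T ->
  f x @[x --> t^'-] --> f t - jump f t.
Proof.
move=> [_ fl] /fl[l fl_l]; rewrite /jump opprB subrKC.
by rewrite (cvg_lim _ fl_l).
Qed.

Lemma cadlag_right_osc f t e : cadlag T f -> 0 <= t < T -> 0 < e ->
  exists2 d : R, 0 < d & forall u, t <= u < t + d -> `|f u - f t| < e.
Proof.
move=> [fr _] /fr /cvgrPdist_lt frt e0; have /near_at_rightP[d d0 H] := frt _ e0.
exists d => // u.
move=> /andP[]; rewrite le_eqVlt => /predU1P[-> _|tu ud].
  by rewrite subrr normr0.
by rewrite distrC H// tu.
Qed.

Lemma cadlag_left_osc f t e : cadlag T f -> 0 < t <= T -> 0 < e ->
  exists2 d : R, 0 < d &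
    forall u, t - d < u < t -> `|f u - (f t - jump f t)| < e.
Proof.
move=> fc tT e0; have /cvgrPdist_lt /(_ _ e0) := cadlag_cvg_left fc tT.
by move=> /near_at_leftP[d d0 H]; exists d => // u utd; rewrite distrC H.
Qed.

Lemma cadlag_bounded f : cadlag T f ->
  exists2 M : R, 0 < M & forall u, 0 <= u <= T -> `|f u| <= M.
Proof.
move=> fc.
have /compact_near_coveringP/near_covering_withinP cov := @segment_compact R 0 T.
(* The covering property is used with the filter of M tending to +oo, so that local bounds yield a
   single one. Near each t the bound comes from f_t on the right and from f_{t-} on the left. *)
have [|M [_ HM]] := cov R +oo (fun M u => `|f u| <= M) _ _.
  move=> t; rewrite /= in_itv/= => tT.
  have [d1 d10 H1] : exists2 d : R, 0 < d &
      forall u, t <= u < t + d -> u <= T -> `|f u| <= `|f t| + 1.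
    have /andP[t0] := tT; rewrite le_eqVlt => /predU1P[->|tT'].
      exists 1 => // u /andP[Tu _] uT.
      by have -> : u = T; [apply/le_anti/andP|rewrite lerDl].
    have [|d d0 H] := cadlag_right_osc fc (t := t) _ ltr01; first by rewrite t0.
    exists d => // u /H /ltW {}H _.
    by rewrite -[f u](subrK (f t)) addrC (le_trans (ler_normD _ _))// lerD2l.
  have [d2 d20 H2] : exists2 d : R, 0 < d &
      forall u, t - d < u < t -> 0 <= u -> `|f u| <= `|f t - jump f t| + 1.
    have /andP[] := tT; rewrite le_eqVlt => /predU1P[<-|t0] tT'.
      by exists 1 => // u /andP[_ u0] /le_lt_trans/(_ u0); rewrite ltxx.
    have [|d d0 H] := cadlag_left_osc fc (t := t) _ ltr01; first by rewrite t0.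
    exists d => // u /H /ltW {}H _.
    rewrite -[f u](subrK (f t - jump f t)) addrC.
    by rewrite (le_trans (ler_normD _ _))// lerD2l.
  exists (ball t (Num.min d1 d2),
          [set M | `|f t| + 1 + (`|f t - jump f t| + 1) < M]).
    split; first by apply: nbhsx_ballx; rewrite lt_min d10.
    exact: nbhs_pinfty_gt.
  move=> [u M]/= [+ HM]; rewrite /ball/= lt_min => /andP[].
  rewrite !ltr_norml => /andP[? ?] /andP[? ?]; rewrite in_itv/= => /andP[u0 uT].
  apply: le_trans (ltW HM); have [tu|ut] := leP t u.
    apply: le_trans (H1 u _ uT) _; first by rewrite tu; lra.
    by rewrite lerDl addr_ge0.
  apply: le_trans (H2 u _ u0) _; first by rewrite ut andbT; lra.
  by rewrite lerDr addr_ge0.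
exists (Num.max 1 (M + 1)); first by rewrite lt_max ltr01.
move=> u uT; rewrite le_max; apply/orP; right.
by apply: HM; rewrite ?ltrDl//= in_itv.
Qed.

Lemma cadlagD f g : cadlag T f -> cadlag T g -> cadlag T (f \+ g).
Proof.
move=> [fr fl] [gr gl]; split=> t tT; first exact: cvgD (fr _ tT) (gr _ tT).
have [lf Hf] := fl _ tT; have [lg Hg] := gl _ tT.
by exists (lf + lg); apply: cvgD.
Qed.

Lemma cadlagZ c f : cadlag T f -> cadlag T (fun x => c * f x).
Proof.
move=> [fr fl]; split=> t tT; first exact: cvgM (cvg_cst _) (fr _ tT).
have [lf Hf] := fl _ tT.
by exists (c * lf); apply: cvgM => //; exact: cvg_cst.
Qed.

Lemma jump_bounded f M : cadlag T f -> (forall u, 0 <= u <= T -> `|f u| <= M) ->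
  forall t, 0 < t <= T -> `|f t - jump f t| <= M.
Proof.
move=> fc fM t tT; have /cvg_norm fl := cadlag_cvg_left fc tT.
apply: (closed_cvg (fun x => x <= M) _ _ _ fl); first exact: closed_le.
have /andP[t0 tT'] := tT.
apply/near_at_leftP; exists t => // u; rewrite subrr => /andP[u0 ut].
by apply: fM; rewrite (ltW u0) (le_trans (ltW ut)).
Qed.

End Cadlag.

(** * Fine partitions around a fixed time *)

Section VanishingPartitions.
Context {R : realType}.
Variables (T : R) (P : nat -> seq R).
Hypothesis P_itv : forall n, itv_partition 0 T (P n).
Hypothesis P_mesh : mesh (P n) @[n --> \oo] --> (0 : R).
Implicit Types (f : R -> R) (e t : R).

Lemma near_mesh_lt e : 0 < e -> \forall n \near \oo, mesh (P n) < e.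
Proof. by move=> e0; exact: cvgr_lt P_mesh _ e0. Qed.

Lemma near_ppoint_oc t e : 0 < e -> \forall n \near \oo, forall k,
  (k < size (P n))%N -> ppoint (P n) k < t <= ppoint (P n) k.+1 ->
  t - e < ppoint (P n) k /\ ppoint (P n) k.+1 < t + e.
Proof.
move=> /near_mesh_lt; apply: filterS => n ne k kp /andP[kt tk].
by have := le_lt_trans (le_mesh kp) ne; split; lra.
Qed.

(** The three bounds say that the increment truncated at t carries the jump, that completing it up
    to t_{k+1} changes little, and that f_{t_k} is close to f_{t-}. The index k is quantified after
    n because it depends on n. *)
Lemma near_sqr_incr_jump f t e : cadlag T f -> 0 < t <= T -> 0 < e ->
  \forall n \near \oo, forall k,
  (k < size (P n))%N -> ppoint (P n) k < t <= ppoint (P n) k.+1 ->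
  [/\ `|(f t - f (ppoint (P n) k)) ^+ 2 - jump f t ^+ 2| <= e,
     `|(f (ppoint (P n) k.+1) - f (ppoint (P n) k)) ^+ 2
       - (f t - f (ppoint (P n) k)) ^+ 2| <= e
   & (f (ppoint (P n) k) - (f t - jump f t)) ^+ 2 <= e].
Proof.
move=> fc tT e0; have [M M0 fM] := cadlag_bounded fc.
have /andP[t0 tT'] := tT.
(* Chosen so that the bound 4M d of [dist_sqr_le] is exactly e. *)
pose d := e / (4 * M).
have d0 : 0 < d by rewrite divr_gt0// mulr_gt0.
have de : 4 * M * d = e by rewrite /d mulrC divfK// gt_eqF// mulr_gt0.
have [dl dl0 Hl] := cadlag_left_osc fc tT d0.
have [dr dr0 Hr] : exists2 dr : R, 0 < dr &
    forall u, t <= u < t + dr -> u <= T -> `|f u - f t| < d.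
  move: tT'; rewrite le_eqVlt => /predU1P[->|tT'].
    exists 1 => // u /andP[Tu _] uT; have -> : u = T by apply/le_anti/andP.
    by rewrite subrr normr0.
  have [|dr dr0 H] := cadlag_right_osc fc (t := t) _ d0; first by rewrite ltW.
  by exists dr => // u /H.
near=> n => k kp kt.
have [lk rk] : t - Num.min dl dr < ppoint (P n) k /\
    ppoint (P n) k.+1 < t + Num.min dl dr.
  move: k kp kt; near: n; apply: near_ppoint_oc.
  by rewrite lt_min dl0.
have {lk} lk : t - dl < ppoint (P n) k by have : Num.min dl dr <= dl; [rewrite ge_min lexx|lra].
have {rk} rk : ppoint (P n) k.+1 < t + dr by have : Num.min dl dr <= dr; [rewrite ge_min lexx orbT|lra].
have /andP[kt1 kt2] := kt.
have fkM : `|f (ppoint (P n) k)| <= M.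
  by rewrite fM// (ppoint_ge0 (P_itv n)) ?(ppoint_leT (P_itv n))// ltnW.
have fk1M : `|f (ppoint (P n) k.+1)| <= M.
  by rewrite fM// (ppoint_ge0 (P_itv n)) ?(ppoint_leT (P_itv n)).
have ftM : `|f t| <= M by rewrite fM// ltW.
split.
  have -> : (f t - f (ppoint (P n) k)) ^+ 2 - jump f t ^+ 2 =
      (f (ppoint (P n) k) - f t) ^+ 2 - ((f t - jump f t) - f t) ^+ 2 by ring.
  apply: le_trans (dist_sqr_le fkM (jump_bounded fc fM tT) ftM) _.
  by rewrite -de ler_wpM2l ?mulr_ge0 ?(ltW M0)// ltW// Hl// lk.
  apply: le_trans (dist_sqr_le fk1M ftM fkM) _.
  rewrite -de ler_wpM2l ?mulr_ge0 ?(ltW M0)// ltW// Hr ?kt2//.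
  exact: ppoint_leT (P_itv n) _ _.
have LM := jump_bounded fc fM tT.
rewrite (le_trans _ (le_trans (dist_sqr_le fkM LM LM) _))//.
  by rewrite subrr expr0n subr0 ler_norm.
by rewrite -de ler_wpM2l ?mulr_ge0 ?(ltW M0)// ltW// Hl// lk.
Unshelve. all: end_near. Qed.

End VanishingPartitions.

(** * Uniform limits of discrete quadratic variations *)

Lemma uniform_itvP {R : realType} (a b : R) (F : nat -> R -> R) (Q : R -> R) :
  {uniform `[a, b], F @ \oo --> Q} <->
  forall e : R, 0 < e ->
    \forall n \near \oo, forall t, a <= t <= b -> `|F n t - Q t| < e.
Proof.
split=> [FQ e e0|FQ].
  apply: (FQ [set h | forall t, a <= t <= b -> `|h t - Q t| < e]).
  apply/uniform_nbhs; exists [set xy | ball xy.1 e xy.2]; split.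
    exact: entourage_ball (PosNum e0).
  move=> h /= H t tab; have := H t; rewrite in_itv/= => /(_ tab).
  by rewrite /ball/= distrC.
move=> A /uniform_nbhs[E []]; rewrite -entourage_from_ballE => -[e /= e0 eE] EA.
rewrite nbhs_filterE /=; apply: filterS (FQ e e0) => n H.
apply: EA => t /=; rewrite in_itv/= => /H; rewrite distrC => tE.
by apply: eE.
Qed.

Section QuadraticVariationPath.
Context {R : realType}.
Variables (T : R) (P : nat -> seq R).
Hypothesis P_itv : forall n, itv_partition 0 T (P n).
Hypothesis P_mesh : mesh (P n) @[n --> \oo] --> (0 : R).
Implicit Types (f Q : R -> R) (e s t : R).

(** The left limit is prescribed and not only required to exist: this ties the jumps of Q to those
    of f, and uniform convergence just before a jump time rests on it. *)
Definition is_qv_path f Q : Prop :=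
  [/\ forall t, 0 <= t < T -> Q x @[x --> t^'+] --> Q t,
      forall t, 0 < t <= T -> Q x @[x --> t^'-] --> Q t - jump f t ^+ 2,
      forall s t, 0 <= s -> s <= t -> t <= T -> Q s <= Q t
    & forall t, 0 <= t <= T -> discrete_qv (P n) f f t @[n --> \oo] --> Q t].

Lemma is_qv_path_cadlag f Q : is_qv_path f Q -> cadlag T Q.
Proof. by move=> [rQ lQ _ _]; split=> // t /lQ; exists (Q t - jump f t ^+ 2). Qed.

Lemma is_qv_path0 f Q : 0 <= T -> is_qv_path f Q -> Q 0 = 0.
Proof.
move=> T0 [_ _ _ /(_ 0)]; rewrite lexx T0 => /(_ isT) Q0.
apply/esym/(cvg_unique _ _ Q0) => //.
rewrite (_ : (fun _ => _) = cst 0); first exact: cvg_cst.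
by apply/funext => n; rewrite (discrete_qv0 (P_itv n)).
Qed.

(** With s < t fixed, a fine partition has t_{k+1} < t for the interval containing s, and completing
    that interval costs at most e. Unlike in [discrete_qv_quasi_mono], no oscillation bound between
    s and t enters. *)
Lemma near_discrete_qv_le f s t e : cadlag T f -> 0 <= s -> s <= t -> t <= T ->
  0 < e -> \forall n \near \oo,
    discrete_qv (P n) f f s <= discrete_qv (P n) f f t + e.
Proof.
move=> fc; rewrite le_eqVlt => /predU1P[<- _ _ e0|s0].
  apply: nearW => n.
  by rewrite (discrete_qv0 (P_itv n)) addr_ge0 ?discrete_qv_ge0// ltW.
rewrite le_eqVlt => /predU1P[<- _ e0|st tT e0].
  by apply: nearW => n; rewrite lerDl ltW.
have sT : 0 < s <= T by rewrite s0 ltW// (lt_le_trans st).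
have ts0 : 0 < t - s by rewrite subr_gt0.
near=> n.
have [k kp ks] := ppoint_bracket_oc (P_itv n) sT.
have [_ kt] : s - (t - s) < ppoint (P n) k /\ ppoint (P n) k.+1 < s + (t - s).
  by move: k kp ks; near: n; exact: near_ppoint_oc.
have [_ + _] :
    [/\ `|(f s - f (ppoint (P n) k)) ^+ 2 - jump f s ^+ 2| <= e,
     `|(f (ppoint (P n) k.+1) - f (ppoint (P n) k)) ^+ 2
       - (f s - f (ppoint (P n) k)) ^+ 2| <= e
   & (f (ppoint (P n) k) - (f s - jump f s)) ^+ 2 <= e].
  by move: k kp ks kt; near: n; apply: filterS (near_sqr_incr_jump P_itv P_mesh fc sT e0) => n H k kp ks _; exact: H.
rewrite ler_norml => /andP[+ _].
rewrite subrKC in kt.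
have := sq_incr_sum_le_discrete_qv (P_itv n) f kp (ltW kt) tT.
have /andP[sk1 sk2] := ks.
rewrite (discrete_qvE (P_itv n) f kp (t := s)) ?(ltW sk1)// sq_incr_sumS.
by lra.
Unshelve. all: end_near. Qed.

Lemma cvg_discrete_qv_le f Q : cadlag T f ->
    (forall t, 0 <= t <= T -> discrete_qv (P n) f f t @[n --> \oo] --> Q t) ->
  forall s t, 0 <= s -> s <= t -> t <= T -> Q s <= Q t.
Proof.
move=> fc fQ s t s0 st tT; apply/ler_addgt0Pr => e e0.
have Qs := fQ s; have Qt := fQ t.
apply: (ler_cvg_to (Qs _) (cvgD (Qt _) (cvg_cst e))).
- by rewrite s0 (le_trans st).
- by rewrite tT (le_trans s0).
exact: near_discrete_qv_le.
Qed.

Lemma discrete_qv_right_osc n f t e : cadlag T f -> 0 <= t < T -> 0 < e ->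
  exists2 d : R, 0 < d & forall u, t <= u < t + d -> u <= T ->
    `|discrete_qv (P n) f f u - discrete_qv (P n) f f t| <= e.
Proof.
move=> fc tT e0; have [M M0 fM] := cadlag_bounded fc.
have [k kp /andP[kt tk]] := ppoint_bracket_co (P_itv n) tT.
have eM : 0 < e / (4 * M) by rewrite divr_gt0// mulr_gt0.
have [d d0 H] := cadlag_right_osc fc tT eM.
exists (Num.min d (ppoint (P n) k.+1 - t)); first by rewrite lt_min d0 subr_gt0.
have /andP[t0 tT'] := tT.
move=> u; rewrite -ltrBlDl lt_min !ltrBlDl => /and3P[tu ud].
rewrite subrKC => uk uT.
rewrite !(discrete_qvE (P_itv n) f kp) ?kt ?(ltW tk)//; last first.
  by rewrite (le_trans kt)// ltW.
have kM : `|f (ppoint (P n) k)| <= M.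
  by rewrite fM// (ppoint_ge0 (P_itv n)) ?(ppoint_leT (P_itv n))// ltnW.
rewrite opprD addrACA subrr add0r.
apply: le_trans (dist_sqr_le (fM _ _) (fM _ _) kM) _.
- by rewrite uT (le_trans t0).
- by rewrite t0 ltW.
by rewrite mulrC -ler_pdivlMr ?mulr_gt0// ltW// H// tu.
Qed.

(** The left limit of <f,f>^n at t has f_{t-} in place of f_t in the last increment. Since f_{t_k}
    is close to f_{t-} only for large n, the drop equals the squared jump only asymptotically. *)
Lemma near_discrete_qv_left_osc f t e : cadlag T f -> 0 < t <= T -> 0 < e ->
  \forall n \near \oo, exists2 d : R, 0 < d & forall u, t - d < u < t ->
    `|discrete_qv (P n) f f u - (discrete_qv (P n) f f t - jump f t ^+ 2)| <= e.
Proof.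
move=> fc tT e0; have [M M0 fM] := cadlag_bounded fc.
have e30 : 0 < e / 3 by rewrite divr_gt0.
near=> n.
have [k kp kt] := ppoint_bracket_oc (P_itv n) tT.
have eM : 0 < (e / 3) / (4 * M) by rewrite divr_gt0// mulr_gt0.
have [d d0 H] := cadlag_left_osc fc tT eM.
have /andP[kt1 kt2] := kt.
have [J1 _ J2] :
    [/\ `|(f t - f (ppoint (P n) k)) ^+ 2 - jump f t ^+ 2| <= e / 3,
     `|(f (ppoint (P n) k.+1) - f (ppoint (P n) k)) ^+ 2
       - (f t - f (ppoint (P n) k)) ^+ 2| <= e / 3
   & (f (ppoint (P n) k) - (f t - jump f t)) ^+ 2 <= e / 3].
  by move: k kp kt {kt1 kt2}; near: n; exact: near_sqr_incr_jump.
exists (Num.min d (t - ppoint (P n) k)); first by rewrite lt_min d0 subr_gt0.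
have /andP[t0 tT'] := tT.
move=> u /andP[tu ut].
have {}tu : t - d < u /\ ppoint (P n) k < u.
  have : Num.min d (t - ppoint (P n) k) <= d by rewrite ge_min lexx.
  have : Num.min d (t - ppoint (P n) k) <= t - ppoint (P n) k.
    by rewrite ge_min lexx orbT.
  by split; lra.
have [tu1 tu2] := tu.
have kM : `|f (ppoint (P n) k)| <= M.
  by rewrite fM// (ppoint_ge0 (P_itv n)) ?(ppoint_leT (P_itv n))// ltnW.
have uM : `|f u| <= M.
  rewrite fM// (le_trans (ltW ut))// andbT (le_trans _ (ltW tu2))//.
  by rewrite (ppoint_ge0 (P_itv n))// ltnW.
have J3 : `|(f u - f (ppoint (P n) k)) ^+ 2 -
    (f t - jump f t - f (ppoint (P n) k)) ^+ 2| <= e / 3.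
  apply: le_trans (dist_sqr_le uM (jump_bounded fc fM tT) kM) _.
  by rewrite mulrC -ler_pdivlMr ?mulr_gt0// ltW// H// tu1.
rewrite !(discrete_qvE (P_itv n) f kp) ?(ltW kt1)//; last first.
  by rewrite (ltW tu2) (le_trans (ltW ut)).
move: J1 J3; rewrite -[(f t - jump f t - _) ^+ 2]sqrrN opprB.
have := sqr_ge0 (f (ppoint (P n) k) - (f t - jump f t)).
rewrite !ler_norml => ? /andP[? ?] /andP[? ?].
by apply/andP; split; lra.
Unshelve. all: end_near. Qed.

(** Three-epsilon argument: by uniformity a single large n transfers the one-sided behaviour of
    <f,f>^n at t to Q. *)
Lemma uniform_limit_is_qv_path f Q : cadlag T f ->
    {uniform `[0, T], (fun n => discrete_qv (P n) f f) @ \oo --> Q} ->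
  is_qv_path f Q.
Proof.
move=> fc /uniform_itvP fQ.
have fQt t : 0 <= t <= T -> discrete_qv (P n) f f t @[n --> \oo] --> Q t.
  move=> tT; apply/cvgrPdist_lt => e e0.
  by apply: filterS (fQ e e0) => n H; rewrite distrC H.
split=> // [t tT|t tT|].
- apply/cvgrPdist_le => e e0; have e30 : 0 < e / 3 by rewrite divr_gt0.
  have [n nQ] := filter_ex (fQ _ e30).
  have [d d0 H] := discrete_qv_right_osc n fc tT e30.
  have /andP[t0 tT'] := tT.
  apply/near_at_rightP; exists (Num.min d (T - t)); first by rewrite lt_min d0 subr_gt0.
  move=> u /andP[tu]; rewrite -ltrBlDl lt_min !ltrBlDl subrKC => /andP[ud uT].
  have := H u; rewrite (ltW tu) ud (ltW uT) => /(_ isT isT).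
  have := nQ u; rewrite (le_trans t0 (ltW tu)) (ltW uT) => /(_ isT).
  have := nQ t; rewrite t0 (ltW tT') => /(_ isT).
  rewrite !ltr_norml !ler_norml => /andP[? ?] /andP[? ?] /andP[? ?].
  by apply/andP; split; lra.
- apply/cvgrPdist_le => e e0; have e30 : 0 < e / 3 by rewrite divr_gt0.
  have [n [nQ [d d0 H]]] :=
    filter_ex (filterI (fQ _ e30) (near_discrete_qv_left_osc fc tT e30)).
  have /andP[t0 tT'] := tT.
  apply/near_at_leftP; exists (Num.min d t); first by rewrite lt_min d0.
  move=> u /andP[tu ut].
  have td : Num.min d t <= d by rewrite ge_min lexx.
  have tt : Num.min d t <= t by rewrite ge_min lexx orbT.
  have ud : t - d < u < t by rewrite ut andbT; lra.
  have uT : 0 <= u <= T by rewrite (le_trans (ltW ut))// andbT; lra.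
  have := H u ud; have := nQ u uT.
  have := nQ t; rewrite (ltW t0) tT' => /(_ isT).
  rewrite !ltr_norml !ler_norml => /andP[? ?] /andP[? ?] /andP[? ?].
  by apply/andP; split; lra.
- exact: cvg_discrete_qv_le fc fQt.
Qed.

(** Quasi-monotonicity sandwiches <f,f>^n on [t0, t1[ between its values at t0 and t1. Pointwise
    convergence is then used at these two times only, and right continuity makes Q t1 - Q t0
    small. *)
Lemma near_discrete_qv_right f Q t0 e :
  cadlag T f -> is_qv_path f Q -> 0 <= t0 <= T -> 0 < e ->
  exists2 d : R, 0 < d & \forall n \near \oo, forall t, t0 <= t < t0 + d -> t <= T ->
    `|discrete_qv (P n) f f t - Q t| < e.
Proof.
move=> fc [rQ lQ Qm fQ] t0T e0; have /andP[t00 t0T'] := t0T.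
have [M M0 fM] := cadlag_bounded fc.
pose a := e / 5; have a0 : 0 < a by rewrite divr_gt0.
(* Two values of f within b of a common value differ by at most 2b, and 4M times 2b is 2a/3, below
   a. *)
pose b := a / (12 * M); have b0 : 0 < b by rewrite divr_gt0// mulr_gt0.
have ab : 4 * M * (b + b) <= a.
  rewrite (_ : 4 * M * (b + b) = 2 / 3 * a); first lra.
  by rewrite /b; field; rewrite gt_eqF.
have fQe t : 0 <= t <= T -> \forall n \near \oo, `|discrete_qv (P n) f f t - Q t| < a.
  move=> /fQ /cvgrPdist_lt /(_ _ a0); apply: filterS => n /=.
  by rewrite distrC.
move: t0T'; rewrite le_eqVlt => /predU1P[t0T'|t0T'].
  exists 1 => //; apply: filterS (fQe _ t0T) => n H t /andP[t0t _] tT.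
  have -> : t = t0 by apply/le_anti; rewrite t0t t0T' tT.
  by rewrite (lt_trans H)// /a; lra.
have t0T1 : 0 <= t0 < T by rewrite t00.
have [d d0 Hd] := cadlag_right_osc fc t0T1 b0.
have /cvgrPdist_lt/(_ _ a0)/near_at_rightP[d' d'0 Hd'] := rQ _ t0T1.
pose t1 := t0 + Num.min (Num.min (d / 2) (d' / 2)) (T - t0).
have [t01 t1d t1d' t1T] : [/\ t0 < t1, t1 < t0 + d, t1 < t0 + d' & t1 <= T].
  have m0 : 0 < Num.min (Num.min (d / 2) (d' / 2)) (T - t0).
    by rewrite !lt_min subr_gt0 t0T' !divr_gt0.
  have m1 : Num.min (Num.min (d / 2) (d' / 2)) (T - t0) <= d / 2.
    by rewrite !ge_min lexx.
  have m2 : Num.min (Num.min (d / 2) (d' / 2)) (T - t0) <= d' / 2.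
    by rewrite !ge_min lexx orbT.
  have m3 : Num.min (Num.min (d / 2) (d' / 2)) (T - t0) <= T - t0.
    by rewrite !ge_min lexx orbT.
  by rewrite /t1; split; lra.
exists (t1 - t0); first by rewrite subr_gt0.
have t1T' : 0 <= t1 <= T by rewrite t1T (le_trans t00)// ltW.
near=> n => t; rewrite subrKC => /andP[t0t tt1] tT.
have Q1 : `|discrete_qv (P n) f f t0 - Q t0| < a by near: n; exact: fQe.
have Q2 : `|discrete_qv (P n) f f t1 - Q t1| < a by near: n; exact: fQe.
have fb u : t0 <= u <= t1 -> `|f u - f t0| < b.
  by move=> /andP[t0u ut1]; rewrite Hd// t0u (le_lt_trans ut1).
have M1 := @discrete_qv_quasi_mono _ _ _ (P_itv n) f M (b + b) t0 t fM t00 t0t tT.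
have M2 := @discrete_qv_quasi_mono _ _ _ (P_itv n) f M (b + b) t t1 fM (le_trans t00 t0t) (ltW tt1) t1T.
have {}M1 : discrete_qv (P n) f f t0 <= discrete_qv (P n) f f t + a.
  apply: le_trans (M1 _) _; last by rewrite lerD2l.
  move=> u /andP[t0u ut]; rewrite ltW// (lt_trans (fb _ _)) ?ltrDl//.
  by rewrite t0u (le_trans ut)// ltW.
have {}M2 : discrete_qv (P n) f f t <= discrete_qv (P n) f f t1 + a.
  apply: le_trans (M2 _) _; last by rewrite lerD2l.
  move=> u /andP[tu ut1].
  have := fb u; rewrite ut1 (le_trans t0t)// => /(_ isT).
  have := fb t; rewrite t0t (ltW tt1)// => /(_ isT).
  by rewrite !ltr_norml ler_norml => /andP[? ?] /andP[? ?]; apply/andP; split; lra.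
have Q3 : Q t0 <= Q t by apply: Qm.
have Q4 : Q t <= Q t1 by apply: Qm => //; [exact: le_trans t0t|exact: ltW].
have := Hd' t1; rewrite t01 t1d' => /(_ isT).
move: Q1 Q2; rewrite /a !ltr_norml in M1 M2 * => /andP[? ?] /andP[? ?] /andP[? ?].
by apply/andP; split; lra.
Unshelve. all: end_near. Qed.

(* The increment of [f] over the partition interval ending beyond [t0] accounts
   for [jump f t0], so just before [t0] the discrete quadratic variation stays
   close to [Q t0 - jump f t0 ^+ 2]. *)
Lemma near_discrete_qv_left f Q t0 e :
  cadlag T f -> is_qv_path f Q -> 0 <= t0 <= T -> 0 < e ->
  exists2 d : R, 0 < d & \forall n \near \oo, forall t, t0 - d < t < t0 -> 0 <= t ->
    `|discrete_qv (P n) f f t - Q t| < e.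
Proof.
move=> fc [rQ lQ Qm fQ] t0T e0; have /andP[t00 t0T'] := t0T.
have [M M0 fM] := cadlag_bounded fc.
(* The upper bound collects five errors: the passage from t to r, the square (f_r - f_{t_k})^2, the
   squared jump, the convergence at t0 and the left limit of Q at t0. *)
pose a := e / 5; have a0 : 0 < a by rewrite divr_gt0.
pose b := a / (12 * M); have b0 : 0 < b by rewrite divr_gt0// mulr_gt0.
have ab : 4 * M * (b + b) <= a.
  rewrite (_ : 4 * M * (b + b) = 2 / 3 * a); first lra.
  by rewrite /b; field; rewrite gt_eqF.
have fQe t : 0 <= t <= T -> \forall n \near \oo, `|discrete_qv (P n) f f t - Q t| < a.
  move=> /fQ /cvgrPdist_lt /(_ _ a0); apply: filterS => n /=.
  by rewrite distrC.
move: t00; rewrite le_eqVlt => /predU1P[<-|t00].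
  exists 1 => //; apply: nearW => n t /andP[_ t0'] /le_lt_trans/(_ t0').
  by rewrite ltxx.
have t0T1 : 0 < t0 <= T by rewrite t00.
have [d d0 Hd] := cadlag_left_osc fc t0T1 b0.
have /cvgrPdist_lt/(_ _ a0)/near_at_leftP[d' d'0 Hd'] := lQ _ t0T1.
pose s := t0 - Num.min (Num.min (d / 2) (d' / 2)) t0.
have [s0 st0 sd sd'] : [/\ 0 <= s, s < t0, t0 - d < s & t0 - d' < s].
  have m0 : 0 < Num.min (Num.min (d / 2) (d' / 2)) t0.
    by rewrite !lt_min t00 !divr_gt0.
  have m1 : Num.min (Num.min (d / 2) (d' / 2)) t0 <= d / 2.
    by rewrite !ge_min lexx.
  have m2 : Num.min (Num.min (d / 2) (d' / 2)) t0 <= d' / 2.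
    by rewrite !ge_min lexx orbT.
  have m3 : Num.min (Num.min (d / 2) (d' / 2)) t0 <= t0.
    by rewrite !ge_min lexx orbT.
  by rewrite /s; split; lra.
exists (t0 - s); first by rewrite subr_gt0.
have sT : 0 <= s <= T by rewrite s0 (le_trans (ltW st0)).
near=> n => t; rewrite opprB subrKC => /andP[st tt0] t_ge0.
have Q1 : `|discrete_qv (P n) f f t0 - Q t0| < a by near: n; exact: fQe.
have Q2 : `|discrete_qv (P n) f f s - Q s| < a by near: n; exact: fQe.
have fb u v : s <= u < t0 -> s <= v < t0 -> `|f u - f v| <= b + b.
  move=> /andP[su ut0] /andP[sv vt0].
  have := Hd u; rewrite ut0 (lt_le_trans sd)// => /(_ isT).
  have := Hd v; rewrite vt0 (lt_le_trans sd)// => /(_ isT).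
  by rewrite !ltr_norml ler_norml => /andP[? ?] /andP[? ?]; apply/andP; split; lra.
have tT : t <= T by rewrite ltW// (lt_le_trans tt0).
have M1 : discrete_qv (P n) f f s <= discrete_qv (P n) f f t + a.
  apply: le_trans (discrete_qv_quasi_mono (P_itv n) fM s0 (ltW st) tT _) _.
    by move=> u /andP[su ut]; apply: fb; rewrite ?lexx// su (le_lt_trans ut).
  by rewrite lerD2l.
have [k kp kt] := ppoint_bracket_oc (P_itv n) t0T1.
have [sk _] : t0 - (t0 - s) < ppoint (P n) k /\ ppoint (P n) k.+1 < t0 + (t0 - s).
  by move: k kp kt; near: n; apply: near_ppoint_oc => //; rewrite subr_gt0.
rewrite opprB subrKC in sk.
have J : `|(f t0 - f (ppoint (P n) k)) ^+ 2 - jump f t0 ^+ 2| <= a.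
  move: k kp kt {sk}; near: n.
  by apply: filterS (near_sqr_incr_jump P_itv P_mesh fc t0T1 a0) => n H k kp /(H k kp)[].
have /andP[kt1 kt2] := kt.
(* The time t may precede t_k. Moving to r costs at most a and reaches the partition interval of t0,
   where the values at r and t0 can be compared explicitly. *)
pose r := Num.max t (ppoint (P n) k).
have [tr rt0 kr] : [/\ t <= r, r < t0 & ppoint (P n) k <= r].
  by rewrite /r le_max lexx gt_max tt0 kt1 le_max lexx orbT.
have rT : r <= T by rewrite ltW// (lt_le_trans rt0).
have M2 : discrete_qv (P n) f f t <= discrete_qv (P n) f f r + a.
  apply: le_trans (discrete_qv_quasi_mono (P_itv n) fM t_ge0 tr rT _) _.
    move=> u /andP[tu ur]; apply: fb.
      by rewrite (le_trans (ltW st))// (le_lt_trans ur).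
    by rewrite (ltW st).
  by rewrite lerD2l.
have M3 : discrete_qv (P n) f f r <=
    discrete_qv (P n) f f t0 - (f t0 - f (ppoint (P n) k)) ^+ 2 + a.
  rewrite !(discrete_qvE (P_itv n) f kp) ?(ltW kt1)//; last first.
    by rewrite kr (le_trans (ltW rt0)).
  rewrite addrK lerD2l.
  have rM : `|f r| <= M by rewrite fM// (le_trans t_ge0).
  have kM : `|f (ppoint (P n) k)| <= M.
    by rewrite fM// (ppoint_ge0 (P_itv n)) ?(ppoint_leT (P_itv n))// ltnW.
  have := dist_sqr_le rM kM kM.
  rewrite subrr expr0n subr0 => /(le_trans (ler_norm _)) /le_trans; apply.
  apply: le_trans ab; rewrite ler_wpM2l ?mulr_ge0 ?(ltW M0)// fb//.
    by rewrite rt0 (le_trans (ltW st)).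
  by rewrite kt1 ltW.
have Q3 : Q s <= Q t by apply: Qm => //; exact: ltW.
have Q4 : Q t <= Q t0 - jump f t0 ^+ 2.
  apply: (closed_cvg (fun x => Q t <= x) _ _ _ (lQ _ t0T1)); first exact: closed_ge.
  apply/near_at_leftP; exists (t0 - t); first by rewrite subr_gt0.
  move=> u; rewrite opprB subrKC => /andP[tu ut0]; apply: Qm => //; first exact: ltW.
  by rewrite ltW// (lt_le_trans ut0).
have := Hd' s; rewrite st0 sd' => /(_ isT).
move: Q1 Q2 J; rewrite /a !ltr_norml ler_norml in M1 M2 M3 * => /andP[? ?] /andP[? ?] /andP[? ?] /andP[? ?].
by apply/andP; split; lra.
Unshelve. all: end_near. Qed.

Lemma is_qv_path_uniform_limit f Q : cadlag T f -> is_qv_path f Q ->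
  {uniform `[0, T], (fun n => discrete_qv (P n) f f) @ \oo --> Q}.
Proof.
move=> fc qvQ; apply/uniform_itvP => e e0.
have /compact_near_coveringP/near_covering_withinP cov := @segment_compact R 0 T.
suff : \forall n \near \oo, `[0, T]%classic `<=`
    (fun t => `|discrete_qv (P n) f f t - Q t| < e).
  apply: filterS => n H t tT; apply: H.
  by rewrite /= in_itv.
apply: (cov nat \oo (fun n t => `|discrete_qv (P n) f f t - Q t| < e)).
move=> t0; rewrite /= in_itv/= => t0T.
have [d1 d10 H1] := near_discrete_qv_right fc qvQ t0T e0.
have [d2 d20 H2] := near_discrete_qv_left fc qvQ t0T e0.
exists (ball t0 (Num.min d1 d2), [set n |
  (forall t, t0 <= t < t0 + d1 -> t <= T -> `|discrete_qv (P n) f f t - Q t| < e) /\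
  (forall t, t0 - d2 < t < t0 -> 0 <= t -> `|discrete_qv (P n) f f t - Q t| < e)]).
  split; first by apply: nbhsx_ballx; rewrite lt_min d10.
  exact: filterI.
move=> [t n]/= [+ [{}H1 {}H2]]; rewrite /ball/= lt_min => /andP[].
rewrite !ltr_norml => /andP[? ?] /andP[? ?]; rewrite in_itv/= => /andP[t_ge0 tT].
have [tt0|tt0] := leP t0 t.
  by rewrite -ltr_norml; apply: H1 => //; rewrite tt0; lra.
by rewrite -ltr_norml; apply: H2 => //; rewrite tt0 andbT; lra.
Qed.

End QuadraticVariationPath.

(** * Finite measures on the line *)

Section FiniteMeasureOnLine.
Context {R : realType}.
Implicit Types (mu : {finite_measure set (measurableTypeR R) -> \bar R}).

Let mitv (i : interval R) : measurable ([set` i] : set (measurableTypeR R)).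
Proof. exact: measurable_itv. Qed.

Lemma fine_measure_ge0 mu (A : set (measurableTypeR R)) : 0 <= fine (mu A).
Proof. exact/fine_ge0/measure_ge0. Qed.

Lemma fine_measure_le mu (i : interval R) (A : set (measurableTypeR R)) :
  measurable A -> A `<=` [set` i] -> fine (mu A) <= fine (mu [set` i]).
Proof.
move=> mA Ai; apply: fine_le; rewrite ?fin_num_measure//.
by apply: le_measure; rewrite ?inE.
Qed.

Lemma measure_itv_oc mu (s t : R) : 0 <= s -> s <= t ->
  fine (mu `]s, t]%classic) = fine (mu `[0, t]%classic) - fine (mu `[0, s]%classic).
Proof.
move=> s0 st; apply/eqP; rewrite eq_sym subr_eq addrC; apply/eqP.
rewrite -fineD ?fin_num_measure// -measureU//.
  by rewrite -itv_bndbnd_setU// bnd_simp.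
by rewrite -subset0 => x /=; rewrite !in_itv/= => -[/andP[_ xs] /andP[]]; rewrite ltNge xs.
Qed.

Lemma measure_itv_oo mu (s t : R) : s < t ->
  fine (mu `]s, t[%classic) = fine (mu `]s, t]%classic) - fine (mu [set t]).
Proof.
move=> st; apply/eqP; rewrite eq_sym subr_eq; apply/eqP.
rewrite -fineD ?fin_num_measure// -measureU//.
  by rewrite setUitv1// bnd_simp.
by rewrite -subset0 => x /=; rewrite !in_itv/= => -[/andP[_ xs] xt]; rewrite xt ltxx in xs.
Qed.

(** Continuity from above at the empty set, available because mu is finite. *)
Lemma near_measure_itv mu (F : nat -> interval R) (e : R) :
    (forall n, [set` F n.+1] `<=` [set` F n]) ->
    (\bigcap_n [set` F n] = set0) -> 0 < e ->
  exists n, fine (mu [set` F n]) < e.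
Proof.
move=> Fd F0 e0.
have : mu \o (fun n => [set` F n]) @ \oo --> mu (\bigcap_n [set` F n]).
  apply: nonincreasing_cvg_mu.
  - by rewrite ltey_eq fin_num_measure.
  - by [].
  - by rewrite F0.
  - apply/nonincreasing_seqP => n; apply/subsetPset; exact: Fd.
rewrite F0 measure0 => /fine_cvg /cvgr_lt /(_ _ e0) H.
by have [n] := filter_ex H; exists n.
Qed.

Lemma measure_cc_right_continuous mu (t : R) : 0 <= t ->
  fine (mu `[0, x]%classic) @[x --> t^'+] --> fine (mu `[0, t]%classic).
Proof.
move=> t0; apply/cvgrPdist_lt => e e0.
have [||n He] := near_measure_itv mu (F := fun n => `]t, t + n.+1%:R^-1]) _ _ e0.
- move=> n x /=; rewrite !in_itv/= => /andP[-> /= /le_trans]; apply.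
  by rewrite lerD2l lef_pV2 ?posrE// ler_nat.
- rewrite -subset0 => x /= H.
  have := H 0%N Logic.I; rewrite /= in_itv/= => /andP[tx _].
  have xt0 : 0 < x - t by rewrite subr_gt0.
  have /(_ (Num.bound (x - t)^-1) Logic.I) := H.
  rewrite /= in_itv/= tx /= -lerBlDl leNgt => /negP; apply.
  rewrite invf_plt ?posrE// (lt_trans (archi_boundP _)) ?invr_ge0 ?ltW//.
  by rewrite ltr_nat.
apply/near_at_rightP; exists n.+1%:R^-1; first by rewrite invr_gt0.
move=> x /andP[tx xn]; rewrite distrC -measure_itv_oc// ?ltW//.
rewrite ger0_norm ?fine_measure_ge0// (le_lt_trans _ He)//.
apply: fine_measure_le => //.
by move=> y /=; rewrite !in_itv/= => /andP[-> /le_trans]; apply; exact: ltW.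
Qed.

(** The atom is split off because the intervals open at t shrink to the empty set, while those
    closed at t shrink to {t}. *)
Lemma measure_cc_left_limit mu (t : R) : 0 < t ->
  fine (mu `[0, x]%classic) @[x --> t^'-] -->
  fine (mu `[0, t]%classic) - fine (mu [set t]).
Proof.
move=> t0; apply/cvgrPdist_lt => e e0.
have [||n He] := near_measure_itv mu (F := fun n => `]t - n.+1%:R^-1, t[) _ _ e0.
- move=> n x /=; rewrite !in_itv/= => /andP[+ ->]; rewrite andbT; apply: le_lt_trans.
  by rewrite lerD2l lerN2 lef_pV2 ?posrE// ler_nat.
- rewrite -subset0 => x /= H.
  have := H 0%N Logic.I; rewrite /= in_itv/= => /andP[_ xt].
  have xt0 : 0 < t - x by rewrite subr_gt0.
  have /(_ (Num.bound (t - x)^-1) Logic.I) := H.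
  rewrite /= in_itv/= xt andbT ltrBlDr -ltrBlDl ltNge => /negP; apply.
  rewrite ltW// invf_plt ?posrE// (lt_trans (archi_boundP _)) ?invr_ge0 ?ltW//.
  by rewrite ltr_nat.
apply/near_at_leftP; exists (Num.min t n.+1%:R^-1).
  by rewrite lt_min t0 invr_gt0/=.
move=> x /andP[tx xt].
have m1 : Num.min t n.+1%:R^-1 <= t by rewrite ge_min lexx.
have m2 : Num.min t n.+1%:R^-1 <= n.+1%:R^-1 by rewrite ge_min lexx orbT.
have x0 : 0 <= x by rewrite ltW//; lra.
rewrite addrAC -measure_itv_oc// ?ltW// -measure_itv_oo//.
rewrite ger0_norm ?fine_measure_ge0// (le_lt_trans _ He)//.
apply: fine_measure_le => //.
move=> y /=; rewrite !in_itv/= => /andP[xy ->]; rewrite andbT (le_lt_trans _ xy)//.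
by rewrite (le_trans _ (ltW tx))// lerD2l lerN2.
Qed.

Lemma lebesgue_stieltjes_measure_itv_oc (F : cumulative R R) (a b : R) :
  a <= b -> lebesgue_stieltjes_measure F `]a, b]%classic = (F b - F a)%:E.
Proof.
move=> ab; rewrite /lebesgue_stieltjes_measure /measure_extension.
by rewrite measurable_mu_extE/=; [exact: wlength_itv_bnd|exact: is_ocitv].
Qed.

(** Frozen outside [0, T], Q becomes a cumulative function on the line. Its Stieltjes measure has no
    atom at 0, since the extension is flat to the left of 0 and right continuous with Q 0 = 0;
    restriction to [0, T] then gives mu. *)
Lemma exists_measure_cc (T : R) (Q : R -> R) : 0 <= T -> Q 0 = 0 ->
    (forall t, 0 <= t < T -> Q x @[x --> t^'+] --> Q t) ->
    (forall s t, 0 <= s -> s <= t -> t <= T -> Q s <= Q t) ->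
  exists mu, mu (~` `[0, T]%classic) = 0%E /\
    forall t, 0 <= t <= T -> mu `[0, t]%classic = (Q t)%:E.
Proof.
move=> T0 Q0 rQ Qm.
pose F x := Q (Num.max 0 (Num.min x T)).
have Fnd : {homo F : x y / x <= y}.
  move=> x y xy; apply: Qm.
  - by rewrite le_max lexx.
  - by rewrite ge_max !le_max lexx/= !le_min !ge_min xy lexx !orbT.
  - by rewrite ge_max T0 ge_min lexx orbT.
have F0 x : x <= 0 -> F x = 0.
  by move=> x0; rewrite /F (min_idPl _) ?(le_trans x0)// (max_idPl _).
have FQ x : 0 <= x <= T -> F x = Q x.
  by move=> /andP[x0 xT]; rewrite /F (min_idPl _)// (max_idPr _).
have Frc : right_continuous F.
  move=> x; have [x0|x0] := ltP x 0.
    rewrite F0 ?ltW//; apply: cvg_near_cst.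
    apply/near_at_rightP; exists (- x); first by rewrite oppr_gt0.
    by move=> u; rewrite subrr => /andP[_ /ltW]; exact: F0.
  have [xT|Tx] := ltP x T.
    rewrite FQ ?x0 ?ltW//.
    apply: (cvg_trans _ (rQ x _)); last by rewrite x0.
    apply: near_eq_cvg; apply/near_at_rightP; exists (T - x).
      by rewrite subr_gt0.
    move=> u; rewrite subrKC => /andP[xu uT].
    by rewrite FQ// (le_trans x0) ?ltW.
  apply: cvg_near_cst; apply/near_at_rightP; exists 1 => // u /andP[xu _].
  by rewrite /F !(min_idPr _)// (le_trans Tx)// ltW.
pose Fc : cumulative R R := HB.pack F (isCumulative.Build R _ R F Fnd Frc).
pose nu : {measure set (measurableTypeR R) -> \bar R} :=
  lebesgue_stieltjes_measure Fc.
have nu_oc a b : a <= b -> nu `]a, b]%classic = (F b - F a)%:E.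
  exact: (lebesgue_stieltjes_measure_itv_oc Fc).
have nu0 : nu [set 0] = 0%E.
  apply: (@subset_measure0 _ _ _ nu _ `](-1), 0]%classic) => //.
    by move=> x ->; rewrite /= in_itv/= lexx ltrN10.
  by rewrite [LHS]nu_oc ?lerN10// !F0 ?subrr// lerN10.
have nu_cc t : 0 <= t <= T -> nu `[0, t]%classic = (Q t)%:E.
  move=> /andP[t0 tT].
  have -> : `[0, t]%classic = [set 0] `|` `]0, t]%classic.
    by rewrite setU1itv// bnd_simp.
  rewrite measureU//; last first.
    by rewrite -subset0 => x /= [->]; rewrite in_itv/= ltxx.
  rewrite [X in (X + _)%E]nu0 add0e [LHS]nu_oc// (F0 0)// subr0 FQ//.
  by rewrite t0.
have nuT : (nu `[0%R, T]%classic < +oo)%E by have := nu_cc T; rewrite lexx T0 => /(_ isT) ->; rewrite ltry.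
exists (mfrestr (mitv `[0, T]) nuT); split.
  have : nu (~` `[0%R, T]%classic `&` `[0%R, T]%classic) = 0%E.
    by rewrite setICl measure0.
  exact.
move=> t tT; rewrite -nu_cc//.
transitivity (nu (`[0%R, t]%classic `&` `[0%R, T]%classic)); first by [].
congr (nu _); apply: setIidl.
move=> x /=; rewrite !in_itv/= => /andP[-> /le_trans]; apply.
by case/andP: tT.
Qed.

End FiniteMeasureOnLine.

Lemma integral_sq_incr_measure {R : realType} (T : R) p (f h : R -> R) :
    itv_partition 0 T p -> {within `[0, T], continuous h} ->
  (\int[sq_incr_measure p f]_(x in `[0%R, T]) (h x)%:E)%E =
  (\sum_(k < size p) h (ppoint p k) *
     (f (ppoint p k.+1) - f (ppoint p k)) ^+ 2)%:E.
Proof.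
move=> pT hc.
pose D : set (measurableTypeR R) := `[0, T]%classic.
have mD : measurable D by exact: measurable_itv.
have mh : measurable_fun D (h : measurableTypeR R -> measurableTypeR R).
  exact: subspace_continuous_measurable_fun.
have mhE : measurable_fun D (EFin \o h : measurableTypeR R -> \bar R).
  exact/measurable_EFinP.
(* The formula is proved for nonnegative integrands and then applied to the positive and negative
   parts of h. *)
have key (g : R -> \bar R) : (forall x, (0 <= g x)%E) ->
    measurable_fun D (g : measurableTypeR R -> \bar R) ->
    (\int[sq_incr_measure p f]_(x in D) g x =
    \sum_(k < size p) ((f (ppoint p k.+1) - f (ppoint p k)) ^+ 2)%:E
      * g (ppoint p k))%E.
  move=> g0 mg.
  rewrite ge0_integral_measure_sum//; apply: eq_bigr => k _.
  rewrite ge0_integral_mscale//; congr (_ * _)%E.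
  rewrite integral_dirac// diracE mem_set ?mul1e// /D/= in_itv/=.
  by rewrite (ppoint_ge0 pT) ?(ppoint_leT pT)// ltnW.
rewrite integralE key//; last exact/measurable_funepos.
rewrite key//; last exact/measurable_funeneg.
under eq_bigr do rewrite funeposE/= -EFin_max -EFinM.
under [X in (_ - X)%E]eq_bigr do rewrite funenegE/= -EFin_max -EFinM.
rewrite !sumEFin -EFinB -sumrB; congr EFin; apply: eq_bigr => k _.
rewrite -mulrBr mulrC; congr (_ * _).
rewrite /Num.max; case: ifPn => h1; case: ifPn => h2; lra.
Qed.

(** * Atoms and squared jumps *)

Section SquaredJumps.
Context {R : realType}.
Implicit Types (mu : {finite_measure set (measurableTypeR R) -> \bar R}).
Implicit Types (f : R -> R) (s t u : R).

Definition sq_jump_sum f s t : \bar R :=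
  (\esum_(u in `]s, t]) (jump f u ^+ 2)%:E)%E.

Lemma sq_jump_sum_ge0 f s t : (0 <= sq_jump_sum f s t)%E.
Proof. by apply: esum_ge0 => u _; rewrite lee_fin sqr_ge0. Qed.

Lemma sq_jump_sumxx f s : sq_jump_sum f s s = 0%E.
Proof. by rewrite /sq_jump_sum set_itvoc0 esum_set0. Qed.

Lemma sq_jump_sumD f r s t : r <= s -> s <= t ->
  sq_jump_sum f r t = (sq_jump_sum f r s + sq_jump_sum f s t)%E.
Proof.
move=> rs st; rewrite /sq_jump_sum (esumID `]-oo, s]%classic); last first.
  by move=> u _; rewrite lee_fin sqr_ge0.
congr (_ + _)%E; congr (esum _ _); apply/seteqP; split => u /=; rewrite !in_itv/=.
- by move=> [/andP[-> _]].
- by move=> /andP[-> us]; rewrite us (le_trans us).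
- by move=> [/andP[ru ->]] /negP; rewrite -ltNge => ->.
- move=> /andP[su ->]; rewrite (le_lt_trans rs)//; split=> //.
  by apply/negP; rewrite -ltNge.
Qed.

Lemma sq_jump_sum_oo f s t : s < t -> sq_jump_sum f s t =
  ((jump f t ^+ 2)%:E + \esum_(u in `]s, t[) (jump f u ^+ 2)%:E)%E.
Proof.
move=> st; rewrite /sq_jump_sum (esumID [set t]); last first.
  by move=> u _; rewrite lee_fin sqr_ge0.
congr (_ + _)%E.
  rewrite (_ : _ `&` _ = [set t]); last first.
    by apply/seteqP; split=> [u []//|u -> /=]; rewrite in_itv/= st lexx.
  by rewrite esum_set1// lee_fin sqr_ge0.
congr (esum _ _); apply/seteqP; split => u /=; rewrite !in_itv/=.
  by move=> [/andP[-> ut]] /eqP utN; rewrite lt_neqAle utN.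
by move=> /andP[-> ut]; rewrite ltW//; split=> // /eqP; rewrite lt_eqF.
Qed.

(** The sum over uncountably many points is a supremum of finite sums, each bounded by the measure
    of a finite set of points. *)
Lemma esum_atoms_le mu (i : interval R) (a : R -> \bar R) :
    (forall u, u \in i -> 0 <= a u)%E ->
    (forall u, u \in i -> a u <= mu [set u])%E ->
  (\esum_(u in [set` i]) a u <= mu [set` i])%E.
Proof.
move=> a0 amu; apply: ge_ereal_sup => _ [A [finA Ai] <-].
apply: (@le_trans _ _ (\sum_(u \in A) mu [set u])%E).
  by apply: lee_fsum => // u /Ai; exact: amu.
rewrite -(@measure_fin_bigcup _ _ _ mu _ A (fun u => [set u]))//; last first.
  by move=> u v _ _ [w [-> ->]].
apply: le_measure; rewrite ?inE//.
  exact: fin_bigcup_measurable.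
by move=> u [v Av ->]; exact: Ai.
Qed.

Variables (T : R) (f : R -> R).
Variable (mu : {finite_measure set (measurableTypeR R) -> \bar R}).

Let Q t := fine (mu `[0, t]%classic).

Lemma continuous_partE t :
  continuous_part mu f t = (mu `[0%R, t]%classic - sq_jump_sum f 0 t)%E.
Proof. by []. Qed.

Lemma continuous_part0 : continuous_part mu f 0 = mu [set 0].
Proof. by rewrite continuous_partE sq_jump_sumxx sube0 set_itv1. Qed.

Section AtomsAreSquaredJumps.
Hypothesis mu_atom : forall t, 0 < t <= T -> fine (mu [set t]) = jump f t ^+ 2.

Let mu_atomE t : 0 < t <= T -> mu [set t] = (jump f t ^+ 2)%:E.
Proof. by move=> /mu_atom <-; rewrite fineK// fin_num_measure. Qed.

Let jumps_le s t : 0 <= s -> t <= T ->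
  (sq_jump_sum f s t <= mu `]s, t]%classic)%E.
Proof.
move=> s0 tT; apply: esum_atoms_le => u; rewrite in_itv/= => /andP[su ut].
  by rewrite lee_fin sqr_ge0.
by rewrite mu_atomE// (le_lt_trans s0)// (le_trans ut).
Qed.

Let jumps_fin s t : 0 <= s -> t <= T -> sq_jump_sum f s t \is a fin_num.
Proof.
move=> s0 tT; rewrite ge0_fin_numE ?sq_jump_sum_ge0//.
by rewrite (le_lt_trans (jumps_le s0 tT))// ltey_eq fin_num_measure.
Qed.

Let c t := Q t - fine (sq_jump_sum f 0 t).

Let cE t : t <= T -> continuous_part mu f t = (c t)%:E.
Proof.
move=> tT; rewrite continuous_partE /c EFinB !fineK ?jumps_fin//.
exact: fin_num_measure.
Qed.

Let cB s t : 0 <= s -> s <= t -> t <= T ->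
  c t - c s = fine (mu `]s, t]%classic) - fine (sq_jump_sum f s t).
Proof.
move=> s0 st tT; rewrite measure_itv_oc// /c (sq_jump_sumD f s0 st).
rewrite fineD ?jumps_fin ?(le_trans st)//.
by rewrite /Q; ring.
Qed.

Let cB_ge0 s t : 0 <= s -> s <= t -> t <= T -> 0 <= c t - c s.
Proof.
move=> s0 st tT; rewrite cB// subr_ge0 fine_le ?jumps_fin//.
  exact: fin_num_measure.
exact: jumps_le.
Qed.

(** Only the jump at t is kept. The bound still tends to 0 as s increases to t, because that jump
    removes exactly the atom of mu at t. *)
Let cB_le s t : 0 <= s -> s < t -> t <= T ->
  c t - c s <= Q t - Q s - jump f t ^+ 2.
Proof.
move=> s0 st tT; rewrite (cB s0 (ltW st) tT) (measure_itv_oc mu s0 (ltW st)) lerD2l lerN2.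
rewrite -lee_fin fineK ?jumps_fin// sq_jump_sum_oo// leeDl//.
by apply: esum_ge0 => u _; rewrite lee_fin sqr_ge0.
Qed.

Lemma continuous_part_continuous : 0 < T ->
  {within `[0, T], continuous (continuous_part mu f)}.
Proof.
move=> T0; apply/subspace_continuousP => t0; rewrite /= in_itv/= => t0T.
have /andP[t00 t0T'] := t0T.
rewrite /from_subspace cE//.
apply: (@cvg_trans _ ((EFin \o c) @ within `[0, T]%classic (nbhs t0))).
  apply: near_eq_cvg; rewrite near_withinE; apply: nearW => t.
  by rewrite /= in_itv/= => /andP[_ tT]; rewrite cE.
apply: cvg_EFin; first exact: nearW.
apply/cvgrPdist_le => e e0.
have [d1 d10 H1] : exists2 d : R, 0 < d &
    forall t, t0 <= t < t0 + d -> t <= T -> `|c t0 - c t| <= e.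
  have /cvgrPdist_le/(_ _ e0)/near_at_rightP[d d0 H] :=
    measure_cc_right_continuous (mu := mu) t00.
  exists d => // t /andP[]; rewrite le_eqVlt => /predU1P[<- _ _|t0t td tT].
    by rewrite subrr normr0 ltW.
  have := H t; rewrite t0t td => /(_ isT).
  have := cB_ge0 t00 (ltW t0t) tT; have := cB_le t00 t0t tT.
  have := sqr_ge0 (jump f t).
  rewrite /Q !ler_norml => ? ? ? /andP[? ?].
  by apply/andP; split; lra.
have [d2 d20 H2] : exists2 d : R, 0 < d &
    forall t, t0 - d < t < t0 -> 0 <= t -> `|c t0 - c t| <= e.
  move: t00; rewrite le_eqVlt => /predU1P[<-|t0_gt0].
    by exists 1 => // t /andP[_ t_lt0]; rewrite leNgt t_lt0.
  have /cvgrPdist_le/(_ _ e0)/near_at_leftP[d d0 H] :=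
    measure_cc_left_limit (mu := mu) t0_gt0.
  exists d => // t tt0 t_ge0; have := H t tt0.
  have /andP[td tt0'] := tt0.
  have := cB_ge0 t_ge0 (ltW tt0') t0T'; have := cB_le t_ge0 tt0' t0T'.
  rewrite mu_atom ?t0_gt0// /Q !ler_norml => ? ? /andP[? ?].
  by apply/andP; split; lra.
rewrite near_withinE; exists (Num.min d1 d2); first by rewrite /= lt_min d10.
move=> t /=; rewrite lt_min !ltr_norml in_itv/=.
move=> /andP[/andP[? ?] /andP[? ?]] /andP[t_ge0 tT].
have [t0t|tt0] := leP t0 t.
  by apply: H1 => //; rewrite t0t/=; lra.
by apply: H2 => //; rewrite tt0 andbT; lra.
Qed.

Lemma continuous_part_nondecreasing :
  {in `[0, T] &,
    {homo continuous_part mu f : s t / s <= t >-> (s <= t)%E}}.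
Proof.
move=> s t; rewrite !in_itv/= => /andP[s0 sT] /andP[t0 tT] st.
by rewrite !cE// lee_fin -subr_ge0 cB_ge0.
Qed.

End AtomsAreSquaredJumps.

(* Monotonicity gives mu {t} >= (jump f t)^2 for every t. Hence the squared jumps
   in ]s, t[ sum up to at most mu ]s, t[, which vanishes as s tends to t, and the
   reverse inequality follows from left continuity at t. *)
Lemma atoms_squared_jumps : 0 < T ->
    {within `[0, T], continuous (continuous_part mu f)} ->
    {in `[0, T] &,
      {homo continuous_part mu f : s t / s <= t >-> (s <= t)%E}} ->
    continuous_part mu f 0 = 0%E ->
  forall t, 0 < t <= T -> fine (mu [set t]) = jump f t ^+ 2.
Proof.
move=> T0 Cc Cm C0.
have C_ge0 t : 0 <= t <= T -> (0 <= continuous_part mu f t)%E.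
  move=> /andP[t0 tT]; rewrite -C0; apply: Cm; rewrite // in_itv/= ?lexx ?t0//.
  exact: ltW.
(* An infinite sum of squared jumps would make the continuous part -oo, contradicting its
   nonnegativity. *)
have jumps_fin s t : 0 <= s -> s <= t -> t <= T -> sq_jump_sum f s t \is a fin_num.
  move=> s0 st tT.
  suff : sq_jump_sum f 0 t \is a fin_num.
    rewrite (sq_jump_sumD f s0 st) !ge0_fin_numE ?adde_ge0 ?sq_jump_sum_ge0//.
    by apply: le_lt_trans; rewrite leeDr// sq_jump_sum_ge0.
  have := C_ge0 t; rewrite (le_trans s0)// tT => /(_ isT).
  rewrite continuous_partE ge0_fin_numE ?sq_jump_sum_ge0// lt_neqAle leey andbT.
  move=> + ; apply: contraTN => /eqP ->.
  by rewrite -(@fineK _ (mu _)) ?fin_num_measure//= addeNy leNgt ltNyr.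
pose c t := Q t - fine (sq_jump_sum f 0 t).
have cE t : 0 <= t <= T -> continuous_part mu f t = (c t)%:E.
  move=> /andP[t0 tT]; rewrite continuous_partE /c EFinB !fineK ?jumps_fin//.
  exact: fin_num_measure.
have cB s t : 0 <= s -> s <= t -> t <= T ->
    c t - c s = fine (mu `]s, t]%classic) - fine (sq_jump_sum f s t).
  move=> s0 st tT; rewrite measure_itv_oc// /c (sq_jump_sumD f s0 st).
    rewrite fineD ?jumps_fin ?(le_trans st)//.
  by rewrite /Q; ring.
have cm s t : 0 <= s -> s <= t -> t <= T -> c s <= c t.
  move=> s0 st tT; have sT : 0 <= s <= T by rewrite s0 (le_trans st).
  have t0T : 0 <= t <= T by rewrite tT (le_trans s0).
  by have := Cm s t; rewrite !in_itv/= sT t0T !cE// lee_fin; apply.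
have atom_ge t : 0 < t <= T -> jump f t ^+ 2 <= fine (mu [set t]).
  move=> /andP[t0 tT].
  have : Q t - Q s @[s --> t^'-] --> Q t - (Q t - fine (mu [set t])).
    by apply: cvgB; [exact: cvg_cst|exact: measure_cc_left_limit].
  rewrite subKr => Qt; apply: (closed_cvg (fun x => jump f t ^+ 2 <= x) _ _ _ Qt).
    exact: closed_ge.
  apply/near_at_leftP; exists t => // s; rewrite subrr => /andP[s0 st].
  have := cm _ _ (ltW s0) (ltW st) tT.
  rewrite -subr_ge0 (cB _ _ (ltW s0) (ltW st) tT) measure_itv_oc ?(ltW s0) ?(ltW st)//.
  rewrite subr_ge0; apply: le_trans.
  rewrite -lee_fin fineK ?(jumps_fin _ _ (ltW s0) (ltW st) tT)// sq_jump_sum_oo// leeDl//.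
  by apply: esum_ge0 => u _; rewrite lee_fin sqr_ge0.
move=> t tT; apply/le_anti/andP; split; last exact: atom_ge.
have /andP[t0 tT'] := tT.
rewrite -subr_le0; apply/ler_addgt0Pr => e e0; rewrite add0r.
have /subspace_continuousP/(_ t) : {within `[0, T], continuous (continuous_part mu f)} by [].
rewrite /from_subspace /= in_itv/= (ltW t0) tT' => /(_ isT); rewrite cE ?(ltW t0)// => /fine_cvgP[_].
move=> /cvgrPdist_lt/(_ _ e0); rewrite near_withinE => -[d /= d0 H].
pose s := t - Num.min (d / 2) t.
have [s0 st sd] : [/\ 0 <= s, s < t & t - d < s].
  have m0 : 0 < Num.min (d / 2) t by rewrite !lt_min t0 !divr_gt0.
  have m1 : Num.min (d / 2) t <= d / 2 by rewrite ge_min lexx.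
  have m2 : Num.min (d / 2) t <= t by rewrite ge_min lexx orbT.
  by rewrite /s; split; lra.
have sT : 0 <= s <= T by rewrite s0 (le_trans (ltW st)).
have := H s; rewrite /= in_itv/= sT cE//= => /(_ _ isT).
rewrite gtr0_norm ?subr_gt0// => cts.
have {cts} : `|c t - c s| < e by apply: cts; lra.
rewrite ger0_norm; last by rewrite subr_ge0 cm// ltW.
move=> /ltW; apply: le_trans.
rewrite (cB _ _ s0 (ltW st) tT').
(* The mass of ]s, t[ cancels in c t - c s, which leaves the atom minus the squared jump as a lower
   bound. *)
have : fine (sq_jump_sum f s t) <= jump f t ^+ 2 + fine (mu `]s, t[%classic).
  rewrite -lee_fin fineK ?(jumps_fin _ _ s0 (ltW st) tT')// sq_jump_sum_oo//.
  rewrite EFinD leeD2l// fineK ?fin_num_measure//.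
  apply: esum_atoms_le => u; rewrite in_itv/= => /andP[su ut].
    by rewrite lee_fin sqr_ge0.
  rewrite -(@fineK _ (mu [set u])) ?fin_num_measure// lee_fin atom_ge//.
  by rewrite (le_lt_trans s0)//= (le_trans (ltW ut)).
rewrite measure_itv_oo//.
by move=> ?; lra.
Qed.
End SquaredJumps.

(** * From the limit measure to the quadratic variation path *)

Section WeightedSquaredIncrements.
Context {R : realType}.
Implicit Types (f w : R -> R) (p : seq R).

(** With an indicator weight over all indices, the partial sum can be compared term by term with
    integrals of test functions against mu_n. *)
Lemma sq_incr_sumE p f k : (k <= size p)%N -> sq_incr_sum p f k =
  \sum_(i < size p) (i < k)%N%:R * (f (ppoint p i.+1) - f (ppoint p i)) ^+ 2.
Proof.
move=> kp; rewrite /sq_incr_sum.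
rewrite (big_ord_widen _ (fun i => (f (ppoint p i.+1) - f (ppoint p i)) ^+ 2) kp).
by rewrite big_mkcond/=; apply: eq_bigr => i _; case: ifP; rewrite ?mul1r ?mul0r.
Qed.

Lemma weighted_sq_incr_le p f w k : (k <= size p)%N ->
    (forall i, (i < size p)%N -> w (ppoint p i) <= (i < k)%N%:R) ->
  \sum_(i < size p) w (ppoint p i) * (f (ppoint p i.+1) - f (ppoint p i)) ^+ 2
  <= sq_incr_sum p f k.
Proof.
move=> kp wk; rewrite sq_incr_sumE//; apply: ler_sum => i _.
by rewrite ler_wpM2r ?sqr_ge0// wk.
Qed.

Lemma weighted_sq_incr_ge p f w k : (k <= size p)%N ->
    (forall i, (i < size p)%N -> (i < k)%N%:R <= w (ppoint p i)) ->
  sq_incr_sum p f k <=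
  \sum_(i < size p) w (ppoint p i) * (f (ppoint p i.+1) - f (ppoint p i)) ^+ 2.
Proof.
move=> kp wk; rewrite sq_incr_sumE//; apply: ler_sum => i _.
by rewrite ler_wpM2r ?sqr_ge0// wk.
Qed.

End WeightedSquaredIncrements.

Section Cutoff.
Context {R : realType}.
Implicit Types (a b x : R).

(** For a < b, a continuous ramp from 1 on ]-oo, a] to 0 on [b, +oo[: on [0, T] it lies between the
    indicators of [0, a] and [0, b]. *)
Definition cutoff a b x : R := Num.max 0 (Num.min 1 ((b - x) / (b - a))).

Lemma cutoff_continuous a b : continuous (cutoff a b).
Proof.
move=> x.
have lin : {for x, continuous (fun x => (b - x) / (b - a))}.
  by apply: cvgM; [apply: cvgB; [exact: cvg_cst|exact: cvg_id]|exact: cvg_cst].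
have cst c : {for x, continuous (fun=> c : R)} by exact: cvg_cst.
exact: (continuous_max (cst 0) (continuous_min (cst 1) lin)).
Qed.

Lemma cutoff_ge0 a b x : 0 <= cutoff a b x.
Proof. by rewrite /cutoff le_max lexx. Qed.

Lemma cutoff_le1 a b x : cutoff a b x <= 1.
Proof. by rewrite /cutoff ge_max ler01 ge_min lexx. Qed.

Lemma cutoff1 a b x : a < b -> x <= a -> cutoff a b x = 1.
Proof.
move=> ab xa; have ba : 0 < b - a by rewrite subr_gt0.
by rewrite /cutoff (min_idPl _) ?(max_idPr _)// ler_pdivlMr// mul1r lerD2l lerN2.
Qed.

Lemma cutoff0 a b x : a < b -> b <= x -> cutoff a b x = 0.
Proof.
move=> ab bx; rewrite /cutoff (max_idPl _)// ge_min; apply/orP; right.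
by rewrite pmulr_lle0 ?invr_gt0 ?subr_gt0// subr_le0.
Qed.

End Cutoff.

Section IntegralOnItv.
Context {R : realType}.
Variable (T : R).
Variable (mu : {finite_measure set (measurableTypeR R) -> \bar R}).
Implicit Types (h : R -> R).

Lemma within_continuous_integrable h : {within `[0, T], continuous h} ->
  mu.-integrable `[0, T]%classic (EFin \o h : measurableTypeR R -> \bar R).
Proof.
move=> hc; apply: measurable_bounded_integrable => //.
- by rewrite ltey_eq fin_num_measure.
- exact: subspace_continuous_measurable_fun.
- have /compact_bounded[M [Mreal HM]] := continuous_compact hc (@segment_compact R 0 T).
  exists M; split=> // y My x xT; apply: HM My _ _.
  by exists x.
Qed.

Lemma integral_cutoff_le a b : a < b ->
  fine (\int[mu]_(x in `[0%R, T]) (cutoff a b x)%:E)%E <= fine (mu `[0, b]%classic).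
Proof.
move=> ab; have hc : {within `[0, T], continuous (cutoff a b)}.
  exact/continuous_subspaceT/cutoff_continuous.
have hi := within_continuous_integrable hc.
have mI : measurable (`[0, T]%classic : set (measurableTypeR R)) by [].
have fin := integrable_fin_num mI hi.
have /integrableP[mh _] := hi.
apply: fine_le; rewrite ?fin_num_measure//.
apply: (@le_trans _ _ (\int[mu]_(x in `[0%R, T]) (\1_`[0%R, b] x)%:E)%E).
  apply: ge0_le_integral => //.
  - by move=> x _; rewrite lee_fin cutoff_ge0.
  - exact/measurable_EFinP/measurable_funTS/measurable_indic.
  move=> x /=; rewrite in_itv/= => /andP[x0 xT]; rewrite lee_fin indicE.
  have [xb|bx] := leP x b; last by rewrite cutoff0// ltW.
  by rewrite mem_set ?cutoff_le1//= in_itv/= x0 xb.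
by rewrite integral_indic//; apply: le_measure; rewrite ?inE//; apply: measurableI.
Qed.

Lemma integral_cutoff_ge a b : a < b -> a <= T ->
  fine (mu `[0, a]%classic) <= fine (\int[mu]_(x in `[0%R, T]) (cutoff a b x)%:E)%E.
Proof.
move=> ab aT; have hc : {within `[0, T], continuous (cutoff a b)}.
  exact/continuous_subspaceT/cutoff_continuous.
have hi := within_continuous_integrable hc.
have mI : measurable (`[0, T]%classic : set (measurableTypeR R)) by [].
have fin := integrable_fin_num mI hi.
have /integrableP[mh _] := hi.
apply: fine_le; rewrite ?fin_num_measure//.
apply: (@le_trans _ _ (\int[mu]_(x in `[0%R, T]) (\1_`[0%R, a] x)%:E)%E).
  rewrite integral_indic//; apply: le_measure; rewrite ?inE//.
    exact: measurableI.
  move=> x /=; rewrite !in_itv/= => /andP[-> xa]; rewrite xa; split=> //.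
  exact: le_trans aT.
apply: ge0_le_integral => //.
- exact/measurable_EFinP/measurable_funTS/measurable_indic.
move=> x /=; rewrite in_itv/= => /andP[x0 xT]; rewrite lee_fin indicE.
have [xa|ax] := leP x a; first by rewrite cutoff1// lern1 leq_b1.
rewrite memNset; first exact: cutoff_ge0.
by rewrite /= in_itv/= x0/= leNgt ax.
Qed.

End IntegralOnItv.

Section WeakConvergence.
Context {R : realType}.
Variables (T : R) (P : nat -> seq R).
Hypothesis T_gt0 : 0 < T.
Hypothesis P_itv : forall n, itv_partition 0 T (P n).
Hypothesis P_mesh : mesh (P n) @[n --> \oo] --> (0 : R).
Implicit Types (f h Q : R -> R).
Implicit Types (mu : {finite_measure set (measurableTypeR R) -> \bar R}).

Lemma weak_cvg_sumP f mu h :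
    {within `[0, T], continuous h} ->
  (\int[sq_incr_measure (P n) f]_(x in `[0%R, T]) (h x)%:E)%E @[n --> \oo] -->
    (\int[mu]_(x in `[0%R, T]) (h x)%:E)%E <->
  \sum_(k < size (P n)) h (ppoint (P n) k) *
     (f (ppoint (P n) k.+1) - f (ppoint (P n) k)) ^+ 2 @[n --> \oo] -->
    fine (\int[mu]_(x in `[0%R, T]) (h x)%:E)%E.
Proof.
move=> hc.
have fin : (\int[mu]_(x in `[0%R, T]) (h x)%:E)%E \is a fin_num.
  exact: integrable_fin_num (within_continuous_integrable mu hc).
under eq_fun do rewrite (integral_sq_incr_measure _ (P_itv _) hc).
rewrite -{1}(fineK fin); split; first by move/fine_cvg.
by move=> H; apply: cvg_EFin => //; exact: nearW.
Qed.

Lemma follmer_measure_is_qv_path f mu : cadlag T f -> follmer_measure T P f mu ->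
  is_qv_path T P f (fun t => fine (mu `[0, t]%classic)).
Proof.
move=> fc [mu0 muw Cc Cm C0].
pose Q t := fine (mu `[0, t]%classic).
have atom := atoms_squared_jumps T_gt0 Cc Cm C0.
have Qm s t : s <= t -> Q s <= Q t.
  move=> st; apply: fine_measure_le => //.
  by move=> x /=; rewrite !in_itv/= => /andP[-> /le_trans]; exact.
split=> //.
- by move=> t /andP[t0 _]; exact: measure_cc_right_continuous.
- by move=> t tT; rewrite -atom//; apply: measure_cc_left_limit; case/andP: tT.
- by move=> s t _ st _; exact: Qm.
have muW h : {within `[0, T], continuous h} ->
  \sum_(k < size (P n)) h (ppoint (P n) k) *
     (f (ppoint (P n) k.+1) - f (ppoint (P n) k)) ^+ 2 @[n --> \oo] -->
    fine (\int[mu]_(x in `[0%R, T]) (h x)%:E)%E.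
  by move=> hc; apply/weak_cvg_sumP => //; exact: muw.
(* At t = 0 all discrete sums vanish, so the limit is right only because mu has no atom at 0. *)
move=> t /andP[]; rewrite le_eqVlt => /predU1P[<- _|t0 tT].
  have -> : fine (mu `[0, 0]%classic) = 0.
    by rewrite set_itv1 -(@continuous_part0 R f mu) C0.
  apply: cvg_near_cst; apply: nearW => n.
  exact: discrete_qv0 (P_itv n) _.
have t0T : 0 < t <= T by rewrite t0.
rewrite -/(Q t); apply/cvgrPdist_le => e e0.
have e30 : 0 < e / 3 by rewrite divr_gt0.
have [b tb Qb] : exists2 b, t < b & Q b <= Q t + e / 3.
  have := measure_cc_right_continuous (mu := mu) (ltW t0).
  move=> /cvgrPdist_le/(_ _ e30)/near_at_rightP[d d0 H].
  exists (t + d / 2); first by rewrite ltrDl divr_gt0.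
  have := H (t + d / 2); rewrite ltrDl divr_gt0// ltrD2l ltr_pdivrMr// ltr_pMr// ltr1n.
  by move=> /(_ isT); rewrite ler_norml /Q => /andP[? _]; lra.
have [s /andP[s0 st] Qs] : exists2 s, 0 < s < t & Q t - jump f t ^+ 2 - e / 3 <= Q s.
  have := measure_cc_left_limit (mu := mu) t0.
  move=> /cvgrPdist_le/(_ _ e30)/near_at_leftP[d d0 H].
  have m0 : 0 < Num.min (d / 2) (t / 2) by rewrite !lt_min !divr_gt0.
  have m1 : Num.min (d / 2) (t / 2) <= d / 2 by rewrite ge_min lexx.
  have m2 : Num.min (d / 2) (t / 2) <= t / 2 by rewrite ge_min lexx orbT.
  exists (t - Num.min (d / 2) (t / 2)); first by apply/andP; split; lra.
  have := H (t - Num.min (d / 2) (t / 2)) _; rewrite -atom//.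
  rewrite /Q => /(_ _)/wrap[]; first by apply/andP; split; lra.
  by rewrite ler_norml => /andP[_ ?]; lra.
(* A ramp from t to b bounds the squares through index k from above by about Q t. A ramp from s to
   s' < t bounds those before index k from below by about Q t minus the squared jump, as t_k > s'
   for large n; the truncated k-th square restores the jump. *)
pose s' := (s + t) / 2.
have [ss' s't] : s < s' /\ s' < t by rewrite /s'; split; lra.
have Hb := muW _ (continuous_subspaceT (@cutoff_continuous R t b)).
have Hs := muW _ (continuous_subspaceT (@cutoff_continuous R s s')).
near=> n.
have [k kp kt] := ppoint_bracket_oc (P_itv n) t0T.
have /andP[kt1 kt2] := kt.
have [J1 J2 _] :
    [/\ `|(f t - f (ppoint (P n) k)) ^+ 2 - jump f t ^+ 2| <= e / 3,
     `|(f (ppoint (P n) k.+1) - f (ppoint (P n) k)) ^+ 2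
       - (f t - f (ppoint (P n) k)) ^+ 2| <= e / 3
   & (f (ppoint (P n) k) - (f t - jump f t)) ^+ 2 <= e / 3].
  by move: k kp kt {kt1 kt2}; near: n; exact: near_sqr_incr_jump.
have [s'k _] : t - (t - s') < ppoint (P n) k /\ ppoint (P n) k.+1 < t + (t - s').
  move: k kp kt {kt1 kt2 J1 J2}; near: n; apply: near_ppoint_oc => //.
  by rewrite subr_gt0.
rewrite opprB subrKC in s'k.
have Ub : sq_incr_sum (P n) f k.+1 <= Q t + e / 3 + e / 3.
  apply: (@le_trans _ _ (\sum_(i < size (P n)) cutoff t b (ppoint (P n) i) *
      (f (ppoint (P n) i.+1) - f (ppoint (P n) i)) ^+ 2)).
    apply: weighted_sq_incr_ge => // i ip; rewrite ltnS; case: leqP => [ik|_].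
      rewrite cutoff1// (le_trans _ (ltW kt1))// (ppoint_le (P_itv n))//.
      exact: ltnW.
    exact: cutoff_ge0.
  apply: (@le_trans _ _ (Q b + e / 3)); last by rewrite lerD2r.
  apply: (@le_trans _ _ (fine (\int[mu]_(x in `[0%R, T]) (cutoff t b x)%:E)%E + e / 3)).
    rewrite -lerBlDl; apply: le_trans (ler_norm _) _.
    by rewrite distrC; near: n; move/cvgrPdist_le : Hb; apply.
  by rewrite lerD2r integral_cutoff_le.
have Lb : Q s - e / 3 <= sq_incr_sum (P n) f k.
  apply: (@le_trans _ _ (\sum_(i < size (P n)) cutoff s s' (ppoint (P n) i) *
      (f (ppoint (P n) i.+1) - f (ppoint (P n) i)) ^+ 2)).
    apply: (@le_trans _ _ (fine (\int[mu]_(x in `[0%R, T]) (cutoff s s' x)%:E)%E - e / 3)).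
      by rewrite lerD2r integral_cutoff_ge// (le_trans (ltW st)).
    rewrite lerBlDr -lerBlDl; apply: le_trans (ler_norm _) _.
    by near: n; move/cvgrPdist_le : Hs; apply.
  apply: weighted_sq_incr_le; first exact: ltnW.
  move=> i ip; case: ltnP => [_|ki]; first exact: cutoff_le1.
  by rewrite cutoff0// (le_trans (ltW s'k))// (ppoint_le (P_itv n))// ltnW.
rewrite (discrete_qvE (P_itv n) f kp) ?(ltW kt1)//.
move: Ub; rewrite sq_incr_sumS => Ub.
move: J1 J2; rewrite !ler_norml => /andP[? ?] /andP[? ?].
by apply/andP; split; lra.
Unshelve. all: end_near. Qed.

End WeakConvergence.

(** * From the quadratic variation path to the limit measure *)

Section StepApproximation.
Context {R : realType}.
Variables (T : R) (p : seq R).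
Hypothesis pT : itv_partition 0 T p.
Implicit Types (h : R -> R) (e x : R).

(** The indicator of [t_j, t_{j+1}[ is written as a difference of indicators of half-lines, whose
    mu_n-masses have known limits. *)
Lemma sum_step (a : nat -> R) x i : (i < size p)%N ->
    ppoint p i <= x < ppoint p i.+1 ->
  \sum_(j < size p) a j * ((x < ppoint p j.+1)%R%:R - (x < ppoint p j)%R%:R) = a i.
Proof.
move=> ip /andP[ix xi]; rewrite (bigD1 (Ordinal ip))//= xi ltNge ix subr0 mulr1.
rewrite big1 ?addr0// => j; rewrite -val_eqE/= => ji.
have [jlti|iltj|/eqP] := ltngtP j i; last by rewrite (negbTE ji).
  have : ppoint p j.+1 <= x by rewrite (le_trans _ ix)// (ppoint_le pT)// ltnW.
  move=> jx; rewrite !ltNge jx (le_trans _ jx) ?subrr ?mulr0//.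
  by rewrite (ppoint_le pT).
have : x < ppoint p j by rewrite (lt_le_trans xi)// (ppoint_le pT)// ltnW.
move=> xj; rewrite xj (lt_le_trans xj) ?subrr ?mulr0//.
by rewrite (ppoint_le pT).
Qed.

Variable (mu : {finite_measure set (measurableTypeR R) -> \bar R}).
Hypothesis mu0 : mu [set 0] = 0%E.

Let Q t := fine (mu `[0, t]%classic).

(** Each interval ]t_k, t_{k+1}] contributes an error of at most e times its mass; the point 0,
    which these intervals omit, has no mass. *)
Lemma Rintegral_step_approx h e : {within `[0, T], continuous h} ->
    (forall j, (j < size p)%N -> forall x, ppoint p j <= x <= ppoint p j.+1 ->
      `|h x - h (ppoint p j)| <= e) ->
  `|fine (\int[mu]_(x in `[0%R, T]) (h x)%:E)%E
    - \sum_(j < size p) h (ppoint p j) * (Q (ppoint p j.+1) - Q (ppoint p j))|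
  <= e * Q T.
Proof.
move=> hc osc.
have hi (i : interval R) : [set` i] `<=` `[0, T]%classic ->
    mu.-integrable [set` i] (EFin \o h : measurableTypeR R -> \bar R).
  by move=> iT; apply: integrableS (within_continuous_integrable mu hc).
suff H k : (k <= size p)%N ->
  `|Rintegral mu `[0, ppoint p k]%classic h
    - \sum_(j < k) h (ppoint p j) * (Q (ppoint p j.+1) - Q (ppoint p j))|
  <= e * Q (ppoint p k).
  by have := H _ (leqnn _); rewrite (ppoint_size pT).
elim: k => [_|k ih kp].
  rewrite big_ord0 subr0 /Q set_itv1 mu0 mulr0.
  rewrite /Rintegral null_set_integral ?normr0//.
  apply: (@measurable_funS _ _ _ _ `[0, T]%classic) => //.
    move=> x ->; rewrite /= in_itv/= lexx.
    by rewrite -(ppoint_size pT) (ppoint_ge0 pT).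
  exact: measurable_int (within_continuous_integrable mu hc).
have k0 : 0 <= ppoint p k by apply: ppoint_ge0 pT _ _; exact: ltnW.
have kk1 : ppoint p k <= ppoint p k.+1 by rewrite (ppoint_le pT).
have k1T : ppoint p k.+1 <= T by rewrite (ppoint_leT pT).
have sub1 : `[0, ppoint p k.+1]%classic `<=` `[0, T]%classic.
  by move=> x; rewrite /= !in_itv/= => /andP[-> /le_trans]; exact.
have sub2 : `]ppoint p k, ppoint p k.+1]%classic `<=` `[0, T]%classic.
  move=> x; rewrite /= !in_itv/= => /andP[kx xk].
  by rewrite (le_trans k0 (ltW kx)) (le_trans xk).
have E : `[0, ppoint p k.+1]%classic =
    `[0, ppoint p k]%classic `|` `]ppoint p k, ppoint p k.+1]%classic.
  by rewrite -itv_bndbnd_setU// bnd_simp.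
rewrite big_ord_recr/= E Rintegral_setU//; last 2 first.
  by rewrite -E; exact: hi.
  rewrite disj_set2E; apply/eqP; rewrite -subset0 => x /=; rewrite !in_itv/=.
  by move=> -[/andP[_ xk] /andP[]]; rewrite ltNge xk.
rewrite opprD addrACA -/(Q (ppoint p k.+1)).
apply: le_trans (ler_normD _ _) _.
have QE : fine (mu `]ppoint p k, ppoint p k.+1]%classic) =
    Q (ppoint p k.+1) - Q (ppoint p k) by exact: measure_itv_oc.
have -> : e * Q (ppoint p k.+1) =
    e * Q (ppoint p k) + e * (Q (ppoint p k.+1) - Q (ppoint p k)) by ring.
apply: lerD; first by apply: ih; exact: ltnW.
rewrite -QE -!Rintegral_cst//.
rewrite -RintegralB//; last 2 first.
  exact: hi.
  exact: finite_measure_integrable_cst.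
have mD : measurable (`]ppoint p k, ppoint p k.+1]%classic : set (measurableTypeR R)).
  by [].
have hB : mu.-integrable `]ppoint p k, ppoint p k.+1]%classic
    (EFin \o (fun x => h x - h (ppoint p k)) : measurableTypeR R -> \bar R).
  exact: (integrableB mD (hi _ sub2) (finite_measure_integrable_cst mu (h (ppoint p k)) mD)).
apply: le_trans (le_normr_Rintegral _ _) _ => //.
apply: le_Rintegral => //.
- exact: (integrable_abse hB).
- exact: finite_measure_integrable_cst.
move=> x /=; rewrite in_itv/= => /andP[kx xk].
by apply: osc => //; rewrite (ltW kx).
Qed.

End StepApproximation.

Section FollmerMeasureOfPath.
Context {R : realType}.
Variables (T : R) (P : nat -> seq R).
Hypothesis T_gt0 : 0 < T.
Hypothesis P_itv : forall n, itv_partition 0 T (P n).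
Hypothesis P_mesh : mesh (P n) @[n --> \oo] --> (0 : R).
Implicit Types (f h Q : R -> R).
Implicit Types (mu : {finite_measure set (measurableTypeR R) -> \bar R}).

(** Uniform continuity of h on the compact interval, with the mesh as distance. *)
Lemma near_mesh_osc h (e : R) : {within `[0, T], continuous h} -> 0 < e ->
  \forall n \near \oo, forall x y, 0 <= x <= T -> 0 <= y <= T ->
    `|y - x| <= mesh (P n) -> `|h y - h x| <= e.
Proof.
move=> /subspace_continuousP hc e0.
have /compact_near_coveringP/near_covering_withinP cov := @segment_compact R 0 T.
suff : \forall n \near \oo, `[0, T]%classic `<=` (fun x => forall y, 0 <= y <= T ->
    `|y - x| <= mesh (P n) -> `|h y - h x| <= e).
  by apply: filterS => n H x y xT yT yx; apply: H; rewrite /= ?in_itv.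
apply: (cov nat \oo (fun n x => forall y, 0 <= y <= T ->
    `|y - x| <= mesh (P n) -> `|h y - h x| <= e)).
move=> x0; rewrite /= in_itv/= => x0T.
have e20 : 0 < e / 2 by rewrite divr_gt0.
have := hc x0; rewrite /= in_itv/= => /(_ x0T)/cvgrPdist_lt/(_ _ e20).
rewrite near_withinE => -[d /= d0 H].
have d20 : 0 < d / 2 by rewrite divr_gt0.
exists (ball x0 (d / 2), [set n | mesh (P n) < d / 2]).
  split; first exact: nbhsx_ballx.
  exact: near_mesh_lt.
move=> [x n] /= [xd nd]; rewrite in_itv/= => xT y yT yx.
move: xd; rewrite /ball/= => xd.
have hx : `|h x0 - h x| < e / 2.
  by apply: H; rewrite /= ?in_itv//=; apply: lt_trans xd _; rewrite gtr_pMr// invf_lt1 ?ltr1n.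
have hy : `|h x0 - h y| < e / 2.
  apply: H; rewrite /= ?in_itv//=.
  have := le_lt_trans yx nd; move: xd; rewrite !ltr_norml => /andP[? ?] /andP[? ?].
  by apply/andP; split; lra.
move: hx hy; rewrite !ltr_norml ler_norml => /andP[? ?] /andP[? ?].
by apply/andP; split; lra.
Qed.

(** Only partition points before b count, yet the limit includes the jump at b: the increment across
    b starts at a point t_k < b. *)
Lemma cvg_sq_incr_before f Q b : cadlag T f -> is_qv_path T P f Q -> 0 <= b <= T ->
  \sum_(k < size (P n)) (ppoint (P n) k < b)%R%:R *
    (f (ppoint (P n) k.+1) - f (ppoint (P n) k)) ^+ 2 @[n --> \oo] --> Q b.
Proof.
move=> fc qvQ /andP[]; rewrite le_eqVlt => /predU1P[<- _|b0 bT].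
  rewrite (is_qv_path0 P_itv (ltW T_gt0) qvQ).
  apply: cvg_near_cst; apply: nearW => n; rewrite big1// => k _.
  by rewrite ltNge (ppoint_ge0 (P_itv n)) ?mul0r// ltnW.
have bT' : 0 < b <= T by rewrite b0.
case: qvQ => _ _ _ /(_ b); rewrite ltW// bT => /(_ isT) fQ.
apply/cvgrPdist_le => e e0; have e20 : 0 < e / 2 by rewrite divr_gt0.
near=> n.
have [k kp kb] := ppoint_bracket_oc (P_itv n) bT'.
have [_ J _] :
    [/\ `|(f b - f (ppoint (P n) k)) ^+ 2 - jump f b ^+ 2| <= e / 2,
     `|(f (ppoint (P n) k.+1) - f (ppoint (P n) k)) ^+ 2
       - (f b - f (ppoint (P n) k)) ^+ 2| <= e / 2
   & (f (ppoint (P n) k) - (f b - jump f b)) ^+ 2 <= e / 2].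
  by move: k kp kb; near: n; exact: near_sqr_incr_jump.
have /andP[kb1 kb2] := kb.
have -> : \sum_(k < size (P n)) (ppoint (P n) k < b)%R%:R *
    (f (ppoint (P n) k.+1) - f (ppoint (P n) k)) ^+ 2 = sq_incr_sum (P n) f k.+1.
  rewrite sq_incr_sumE//; apply: eq_bigr => i _; congr (_%:R * _).
  rewrite ltnS; case: leqP => [ik|ki].
    by rewrite (le_lt_trans _ kb1)// (ppoint_le (P_itv n))// ltnW.
  by rewrite ltNge (le_trans kb2)// (ppoint_le (P_itv n))// ltnW.
have : `|Q b - discrete_qv (P n) f f b| <= e / 2.
  by near: n; move/cvgrPdist_le : fQ; apply.
rewrite (discrete_qvE (P_itv n) f kp) ?(ltW kb1)// sq_incr_sumS.
move: J; rewrite !ler_norml => /andP[? ?] /andP[? ?].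
by apply/andP; split; lra.
Unshelve. all: end_near. Qed.

Lemma is_qv_path_weak_cvg f Q mu : cadlag T f -> is_qv_path T P f Q ->
    (forall t, 0 <= t <= T -> mu `[0, t]%classic = (Q t)%:E) ->
  weak_cvg_on T (fun n => sq_incr_measure (P n) f) mu.
Proof.
move=> fc qvQ muQ h hc; apply/(weak_cvg_sumP P_itv f mu hc).
have Q0 := is_qv_path0 P_itv (ltW T_gt0) qvQ.
have mu0 : mu [set 0] = 0%E by rewrite -set_itv1 muQ ?Q0// lexx ltW.
have QT0 : 0 <= Q T by case: qvQ => _ _ /(_ 0 T) + _; rewrite Q0 => ->//; exact: ltW.
apply/cvgrPdist_le => e e0.
(* Three errors add up to e: a Q T for the step approximation under mu, a for the convergence of
   [S_ n], and a (Q T + 1) for the step approximation under mu_n. *)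
pose a := e / (Q T + Q T + 2).
have a0 : 0 < a by rewrite divr_gt0//; lra.
have ae : a * Q T + a + a * (Q T + 1) = e.
  have d0 : Q T + Q T + 2 != 0 by apply/lt0r_neq0; lra.
  rewrite -(divfK d0 e) -/a; ring.
(* The coarse partition P m stays fixed while n grows, so convergence is needed only at its finitely
   many points. *)
have [m Hm] := filter_ex (near_mesh_osc hc a0).
pose p := P m; have pT : itv_partition 0 T p := P_itv m.
have osc j : (j < size p)%N -> forall x, ppoint p j <= x <= ppoint p j.+1 ->
    `|h x - h (ppoint p j)| <= a.
  move=> jp x /andP[jx xj]; apply: Hm.
  - by rewrite (ppoint_ge0 pT) ?(ppoint_leT pT)// ltnW.
  - by rewrite (le_trans _ jx) ?(ppoint_ge0 pT) ?(le_trans xj) ?(ppoint_leT pT)// ltnW.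
  - by rewrite ger0_norm ?subr_ge0// (le_trans _ (le_mesh jp))// lerD2r.
pose S := \sum_(j < size p) h (ppoint p j) * (Q (ppoint p j.+1) - Q (ppoint p j)).
have IS : `|fine (\int[mu]_(x in `[0%R, T]) (h x)%:E)%E - S| <= a * Q T.
  have muQ' t : 0 <= t <= T -> fine (mu `[0, t]%classic) = Q t.
    by move=> tT; rewrite muQ.
  have := Rintegral_step_approx pT mu0 hc osc.
  rewrite (muQ' T); last by rewrite lexx ltW.
  under eq_bigr => j _.
    rewrite !muQ' ?(ppoint_ge0 pT) ?(ppoint_leT pT) ?(ltnW (ltn_ord j))//.
    over.
  by [].
pose B n b := \sum_(k < size (P n)) (ppoint (P n) k < b)%R%:R *
    (f (ppoint (P n) k.+1) - f (ppoint (P n) k)) ^+ 2.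
pose S_ n := \sum_(j < size p) h (ppoint p j) * (B n (ppoint p j.+1) - B n (ppoint p j)).
have SS : S_ n @[n --> \oo] --> S.
  apply: (cvg_big add_continuous) => j _; apply: cvgM; first exact: cvg_cst.
  apply: cvgB; apply: cvg_sq_incr_before => //.
    by rewrite (ppoint_ge0 pT) ?(ppoint_leT pT).
  by rewrite (ppoint_ge0 pT) ?(ppoint_leT pT)// ltnW.
have WS n : `|\sum_(k < size (P n)) h (ppoint (P n) k) *
    (f (ppoint (P n) k.+1) - f (ppoint (P n) k)) ^+ 2 - S_ n|
    <= a * discrete_qv (P n) f f T.
  have -> : S_ n = \sum_(k < size (P n)) (\sum_(j < size p) h (ppoint p j) *
      ((ppoint (P n) k < ppoint p j.+1)%R%:R - (ppoint (P n) k < ppoint p j)%R%:R)) *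
      (f (ppoint (P n) k.+1) - f (ppoint (P n) k)) ^+ 2.
    under eq_bigr do rewrite mulr_suml.
    rewrite exchange_big/=; apply: eq_bigr => j _.
    rewrite /B -sumrB mulr_sumr; apply: eq_bigr => k _.
    by rewrite -mulrBl mulrA.
  rewrite -sumrB -(ppoint_size (P_itv n)) (discrete_qv_ppoint (P_itv n))//.
  rewrite mulr_sumr (le_trans (ler_norm_sum _ _ _))//; apply: ler_sum => k _.
  rewrite -mulrBl normrM (ger0_norm (sqr_ge0 _)) ler_wpM2r ?sqr_ge0//.
  have kT : 0 <= ppoint (P n) k < T.
    rewrite (ppoint_ge0 (P_itv n)) ?(ltnW (ltn_ord k))//=.
    by rewrite -(ppoint_size (P_itv n)) (ppoint_lt (P_itv n)).
  have [i ip /andP[ik ki]] := ppoint_bracket_co pT kT.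
  rewrite (sum_step pT (fun j => h (ppoint p j)) ip) ?ik//.
  by apply: osc => //; rewrite ik ltW.
have fQT : discrete_qv (P n) f f T @[n --> \oo] --> Q T.
  by case: qvQ => _ _ _; apply; rewrite lexx ltW.
near=> n.
have W1 := WS n.
have W2 : discrete_qv (P n) f f T <= Q T + 1.
  rewrite -lerBlDl; apply: le_trans (ler_norm _) _; rewrite distrC.
  by near: n; move/cvgrPdist_le : fQT; apply.
have W3 : `|S - S_ n| <= a by near: n; move/cvgrPdist_le : SS; apply.
have {}W1 := le_trans W1 (ler_wpM2l (ltW a0) W2).
move: IS W1 W3; rewrite !ler_norml -ae => /andP[? ?] /andP[? ?] /andP[? ?].
by apply/andP; split; lra.
Unshelve. all: end_near. Qed.

Lemma is_qv_path_follmer f Q : cadlag T f -> is_qv_path T P f Q ->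
  has_follmer_qv1 T P f.
Proof.
move=> fc qvQ; have Q0 := is_qv_path0 P_itv (ltW T_gt0) qvQ.
have [rQ lQ Qm fQ] := qvQ.
have [mu [muT muQ]] := exists_measure_cc (ltW T_gt0) Q0 rQ Qm.
(* Both expressions are the drop from Q t to the left limit of Q at t. *)
have atom t : 0 < t <= T -> fine (mu [set t]) = jump f t ^+ 2.
  move=> tT; have /andP[t0 tT'] := tT.
  have := lQ _ tT.
  have Qt : Q t = fine (mu `[0, t]%classic) by rewrite muQ// ltW.
  have : Q x @[x --> t^'-] --> Q t - fine (mu [set t]).
    rewrite Qt; apply: cvg_trans (measure_cc_left_limit (mu := mu) t0).
    apply: near_eq_cvg; apply/near_at_leftP; exists t => // s.
    rewrite subrr => /andP[s0 st]; rewrite muQ// ltW//=.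
    by rewrite (le_trans (ltW st)).
  move=> H1 H2.
  have E : Q t - fine (mu [set t]) = Q t - jump f t ^+ 2.
    exact: cvg_unique H1 H2.
  by lra.
exists mu; split=> //.
- exact: is_qv_path_weak_cvg qvQ muQ.
- exact: continuous_part_continuous.
- exact: continuous_part_nondecreasing.
- by rewrite continuous_part0 -set_itv1 muQ ?Q0// lexx ltW.
Qed.

End FollmerMeasureOfPath.

(** * Polarization *)

(** Variation reads only values in [a, b]. This transfers it to [bracket], which is identified with
    a polarized path on [0, T] only. *)
Lemma eq_bounded_variation {R : realType} (a b : R) (f g : R -> R) :
  {in `[a, b], f =1 g} -> bounded_variation a b f -> bounded_variation a b g.
Proof.
move=> fg [M HM]; exists M => _ [s abs <-].
have -> : variation a b g s = variation a b f s.
  have inab m : (m < (size s).+1)%N -> nth b (a :: s) m \in `[a, b].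
    by move=> ms; rewrite in_itv/= (itv_partition_nth_ge ms abs) (itv_partition_nth_le ms abs).
  rewrite /variation !big_nat; apply: eq_bigr => k /andP[_ ks].
  by rewrite !compE -!fg// inab// ltnS ltnW.
by apply: HM; exact: variations_variation.
Qed.

Lemma component_cadlag {R : realType} (T : R) (d : nat) (S : R -> 'rV[R]_d) i :
  cadlag T S -> cadlag T (component S i).
Proof.
move=> [Sr Sl]; split=> t tT.
  exact: (cvg_comp _ _ (Sr t tT) (@coord_continuous R 1 d ord0 i (S t))).
have [l Hl] := Sl t tT; exists (l ord0 i).
exact: (cvg_comp _ _ Hl (@coord_continuous R 1 d ord0 i l)).
Qed.

Section UniformItv.
Context {R : realType}.
Variables (a b : R).
Implicit Types (F G : nat -> R -> R) (Q H : R -> R).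

Lemma uniform_itvD F G Q H :
  {uniform `[a, b], F @ \oo --> Q} -> {uniform `[a, b], G @ \oo --> H} ->
  {uniform `[a, b], (fun n t => F n t + G n t) @ \oo --> (fun t => Q t + H t)}.
Proof.
move=> /uniform_itvP FQ /uniform_itvP GH; apply/uniform_itvP => e e0.
have e20 : 0 < e / 2 by rewrite divr_gt0.
near=> n => t tab; rewrite opprD addrACA.
rewrite (le_lt_trans (ler_normD _ _))// [e]splitr ltrD//.
  by move: t tab; near: n; exact: FQ.
by move: t tab; near: n; exact: GH.
Unshelve. all: end_near. Qed.

Lemma uniform_itv_eq F G Q H :
  (forall n t, a <= t <= b -> `|G n t - H t| <= `|F n t - Q t|) ->
  {uniform `[a, b], F @ \oo --> Q} -> {uniform `[a, b], G @ \oo --> H}.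
Proof.
move=> GF /uniform_itvP FQ; apply/uniform_itvP => e /FQ; apply: filterS => n FQn.
by move=> t tab; rewrite (le_lt_trans (GF _ _ tab))// FQn.
Qed.

End UniformItv.

Section Polarization.
Context {R : realType}.
Variables (T : R) (P : nat -> seq R).
Hypothesis T_gt0 : 0 < T.
Hypothesis P_itv : forall n, itv_partition 0 T (P n).
Hypothesis P_mesh : mesh (P n) @[n --> \oo] --> (0 : R).
Implicit Types (f g Q : R -> R).

Lemma uniform_riemann_discrete_qv f g :
  (exists I, {uniform `[0, T], (fun n => sym_riemann_sum (P n) f g) @ \oo --> I}) <->
  (exists Q, {uniform `[0, T], (fun n => discrete_qv (P n) f g) @ \oo --> Q}).
Proof.
split=> -[H FH]; exists (fun t => f t * g t - f 0 * g 0 - H t);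
  apply: uniform_itv_eq FH => n t tT.
- by rewrite (integration_by_parts_discrete (P_itv n) f g tT) distrC le_eqVlt;
    apply/orP; left; apply/eqP; congr `|_|; ring.
- by rewrite (integration_by_parts_discrete (P_itv n) f g tT) distrC le_eqVlt;
    apply/orP; left; apply/eqP; congr `|_|; ring.
Qed.

Lemma discrete_qvDD p f g t : discrete_qv p (f \+ g) (f \+ g) t =
  discrete_qv p f f t + discrete_qv p g g t
  + (discrete_qv p f g t + discrete_qv p f g t).
Proof.
rewrite /discrete_qv -!big_split/=; apply: eq_bigr => k _.
by rewrite /stopped_incr /=; ring.
Qed.

Definition polar (Qfg Qf Qg : R -> R) (t : R) : R := 2^-1 * (Qfg t - Qf t - Qg t).

Lemma uniform_discrete_qv_polar f g Qfg Qf Qg :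
  cadlag T f -> cadlag T g ->
  is_qv_path T P (f \+ g) Qfg -> is_qv_path T P f Qf -> is_qv_path T P g Qg ->
  {uniform `[0, T], (fun n => discrete_qv (P n) f g) @ \oo --> polar Qfg Qf Qg}.
Proof.
move=> fc gc qfg qf qg; apply/uniform_itvP => e e0.
have e20 : 0 < e / 2 by rewrite divr_gt0.
have /uniform_itvP H1 := is_qv_path_uniform_limit P_itv P_mesh (cadlagD fc gc) qfg.
have /uniform_itvP H2 := is_qv_path_uniform_limit P_itv P_mesh fc qf.
have /uniform_itvP H3 := is_qv_path_uniform_limit P_itv P_mesh gc qg.
near=> n => t tT; rewrite discrete_qv_polarization /polar.
have : `|discrete_qv (P n) (f \+ g) (f \+ g) t - Qfg t| < e / 2.
  by move: t tT; near: n; exact: H1.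
have : `|discrete_qv (P n) f f t - Qf t| < e / 2.
  by move: t tT; near: n; exact: H2.
have : `|discrete_qv (P n) g g t - Qg t| < e / 2.
  by move: t tT; near: n; exact: H3.
rewrite !ltr_norml => /andP[? ?] /andP[? ?] /andP[? ?].
by apply/andP; split; lra.
Unshelve. all: end_near. Qed.

Lemma polar_cadlag Qfg Qf Qg : cadlag T Qfg -> cadlag T Qf -> cadlag T Qg ->
  cadlag T (polar Qfg Qf Qg).
Proof.
move=> c1 c2 c3; rewrite (_ : polar _ _ _ =
  (fun x => 2^-1 * Qfg x) \+ ((fun x => - 2^-1 * Qf x) \+ (fun x => - 2^-1 * Qg x))).
  by do 2?apply: cadlagD; apply: cadlagZ.
by apply/funext => t; rewrite /polar /=; ring.
Qed.

(** A polarized path is a difference of nondecreasing functions. *)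
Lemma polar_bounded_variation f g h Qfg Qf Qg :
    is_qv_path T P f Qfg -> is_qv_path T P g Qf -> is_qv_path T P h Qg ->
  bounded_variation 0 T (polar Qfg Qf Qg).
Proof.
have bv f' Q : is_qv_path T P f' Q -> bounded_variation 0 T (fun t => 2^-1 * Q t).
  move=> [_ _ Qm _]; apply: nondecreasing_bounded_variation => s t.
  rewrite !in_itv/= => /andP[s0 _] /andP[_ tT] st.
  by rewrite ler_pM2l ?invr_gt0// Qm.
move=> /bv b1 /bv b2 /bv b3.
rewrite (_ : polar _ _ _ = (fun x => 2^-1 * Qfg x) \+
  (\- ((fun x => 2^-1 * Qf x) \+ (fun x => 2^-1 * Qg x)))).
  apply: bounded_variationD => //; apply: bounded_variationN.
  exact: bounded_variationD.
by apply/funext => t; rewrite /polar /=; ring.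
Qed.

(** Whichever candidate [get] selects, its distribution function is the pointwise limit of <f,f>^n,
    which is unique. *)
Lemma follmer_qvE f Q t : cadlag T f -> is_qv_path T P f Q -> 0 <= t <= T ->
  follmer_qv T P f t = Q t.
Proof.
move=> fc qvQ tT; have [mu muf] := is_qv_path_follmer T_gt0 P_itv P_mesh fc qvQ.
have [nu nuf ->] : [set q | exists2 mu : {finite_measure set (measurableTypeR R) -> \bar R},
    follmer_measure T P f mu & forall t, q t = fine (mu `[0, t]%classic)]
    (follmer_qv T P f).
  by apply: getPex; exists (fun t => fine (mu `[0, t]%classic)); exists mu.
have [_ _ _ /(_ t tT) H1] := follmer_measure_is_qv_path T_gt0 P_itv P_mesh fc nuf.
case: qvQ => _ _ _ /(_ t tT) H2.
exact: cvg_unique H1 H2.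
Qed.

End Polarization.

(** * The equivalences and the identities *)

Unset Implicit Arguments.

Theorem proposition2p17 (R : realType) (T : R) (d : nat) (S : R -> 'rV[R]_d)
    (P : nat -> seq R) (T_gt0 : 0 < T) (S_cadlag : cadlag T S)
    (P_partitions : nested_vanishing_partitions T P) :
  [/\ riemann_sums_cvg T P S <-> discrete_qv_cvg T P S,
      discrete_qv_cvg T P S <-> has_follmer_qv T P S
    & discrete_qv_cvg T P S ->
      forall i j : 'I_d,
        [/\ bounded_variation 0 T (bracket P (component S i) (component S j)),
            forall t, t \in `[0, T] ->
              follmer_covariation T P (component S i) (component S j) t =
              bracket P (component S i) (component S j) t
          & forall t, t \in `[0, T] ->
              component S i t * component S j t =
              component S i 0 * component S j 0
              + sym_integral P (component S i) (component S j) t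
              + bracket P (component S i) (component S j) t]].
Proof.
case: P_partitions => P_itv _ P_mesh.
set f := component S.
have fc i : cadlag T (f i) by exact: component_cadlag.
(* Condition (ii) without the cadlag requirement, which is what (i) yields directly; the cadlag
   property is recovered by passing through [paths]. *)
pose unif := forall i j, exists Q,
  {uniform `[0, T], (fun n => discrete_qv (P n) (f i) (f j)) @ \oo --> Q}.
pose paths := forall i j, (exists Q, is_qv_path T P (f i) Q) /\
  (exists Q, is_qv_path T P (f i \+ f j) Q).
have unif_paths : unif -> paths.
  move=> U i j; split.
    have [Q /(uniform_limit_is_qv_path P_itv P_mesh (fc i))] := U i i.
    by exists Q.
  have [Qi Ui] := U i i; have [Qj Uj] := U j j; have [Qij Uij] := U i j.
  exists (fun t => Qi t + Qj t + (Qij t + Qij t)).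
  apply: uniform_limit_is_qv_path => //; first exact: cadlagD.
  apply: uniform_itv_eq (uniform_itvD (uniform_itvD Ui Uj) (uniform_itvD Uij Uij)).
  by move=> n t tT; rewrite discrete_qvDD.
have paths_qv : paths -> discrete_qv_cvg T P S.
  move=> H i j; have [[Qi qi] [Qij qij]] := H i j; have [[Qj qj] _] := H j i.
  exists (polar Qij Qi Qj).
    exact: polar_cadlag (is_qv_path_cadlag qij) (is_qv_path_cadlag qi)
      (is_qv_path_cadlag qj).
  exact: uniform_discrete_qv_polar.
have qv_unif : discrete_qv_cvg T P S -> unif.
  by move=> H i j; have [Q _ UQ] := H i j; exists Q.
have riemann_unif : riemann_sums_cvg T P S <-> unif.
  by split=> H i j; apply/(uniform_riemann_discrete_qv P_itv); exact: H.
have paths_follmer : paths <-> has_follmer_qv T P S.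
  have path1 g : cadlag T g -> (exists Q, is_qv_path T P g Q) <-> has_follmer_qv1 T P g.
    move=> gc; split=> [[Q]|[mu]]; first exact: is_qv_path_follmer.
    by move=> muf; eexists; exact: follmer_measure_is_qv_path muf.
  have p1 i := path1 _ (fc i); have p2 i j := path1 _ (cadlagD (fc i) (fc j)).
  by split=> H i j; have [H1 H2] := H i j; split;
    [exact: (p1 i).1 H1|exact: (p2 i j).1 H2|exact: (p1 i).2 H1|exact: (p2 i j).2 H2].
split.
- by rewrite riemann_unif; split=> [/unif_paths/paths_qv|/qv_unif].
- by rewrite -paths_follmer; split=> [/qv_unif/unif_paths|/paths_qv].
move=> /qv_unif/unif_paths H i j.
have [[Qi qi] [Qij qij]] := H i j; have [[Qj qj] _] := H j i.
have qvE t : 0 <= t <= T ->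
    discrete_qv (P n) (f i) (f j) t @[n --> \oo] --> polar Qij Qi Qj t.
  move=> tT.
  have /uniform_itvP U : {uniform `[0, T], (fun n => discrete_qv (P n) (f i) (f j)) @ \oo -->
      polar Qij Qi Qj} by exact: uniform_discrete_qv_polar.
  apply/cvgrPdist_lt => e /U; apply: filterS => n /(_ t tT).
  by rewrite distrC.
have bracketE t : 0 <= t <= T -> bracket P (f i) (f j) t = polar Qij Qi Qj t.
  by move=> tT; apply/cvg_lim => //; exact: qvE.
split.
- apply: (@eq_bounded_variation _ _ _ (polar Qij Qi Qj)); last exact: polar_bounded_variation qij qi qj.
  by move=> t; rewrite in_itv/= => tT; rewrite bracketE.
- move=> t; rewrite in_itv/= => tT; rewrite bracketE// /follmer_covariation.
  by rewrite (follmer_qvE T_gt0 P_itv P_mesh (cadlagD (fc i) (fc j)) qij tT)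
    (follmer_qvE T_gt0 P_itv P_mesh (fc i) qi tT)
    (follmer_qvE T_gt0 P_itv P_mesh (fc j) qj tT).
- move=> t; rewrite in_itv/= => tT; rewrite bracketE//.
  have -> : sym_integral P (f i) (f j) t =
      f i t * f j t - f i 0 * f j 0 - polar Qij Qi Qj t.
    apply/cvg_lim => //.
    rewrite (_ : (fun n => _) = fun n => f i t * f j t - f i 0 * f j 0
      - discrete_qv (P n) (f i) (f j) t).
      by apply: cvgB; [exact: cvg_cst|exact: qvE].
    apply/funext => n.
    by rewrite (integration_by_parts_discrete (P_itv n) (f i) (f j) tT); ring.
  by ring.
Qed.
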